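(* Let $n\ge 2$, let $\Omega\subset\mathbb{R}^n$ be a bounded open set with Lipschitz boundary, let $\beta>0$ and let $f\in L^\infty(\Omega)$ be non-negative. Then the function $\overline v_\infty(x)=\frac1\beta+d(x,\partial\Omega)$ is the unique minimizer of $$J_\infty(\varphi)=-\int_\Omega f\varphi\,dx$$ in the class $\{\varphi\in W^{1,\infty}(\Omega):\ \|\nabla\varphi\|_{L^\infty(\Omega)}\le1,\ \beta\|\varphi\|_{L^\infty(\partial\Omega)}\le1\}$ if and only if $\mathcal{R}\subset\operatorname{Supp}f$.
   Context: $d(x,\partial\Omega)=\inf_{y\in\partial\Omega}|x-y|$. $\mathcal{R}$ denotes the set of points $x\in\Omega$ for which the distance $d(x,\partial\Omega)$ is achieved by more than one point $y\in\partial\Omega$ (the singular set of $\nabla d(\cdot,\partial\Omega)$). $\operatorname{Supp}f$ is the (closed, essential) support of $f$, i.e. the complement of the largest open set on which $f=0$ almost everywhere. *)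

(* Defs.v *)
From HB Require Import structures.
From mathcomp Require Import all_boot all_order all_algebra.
From mathcomp Require Import all_classical all_reals all_analysis.

Set Implicit Arguments.
Unset Strict Implicit.
Unset Printing Implicit Defensive.

Import Order.TTheory GRing.Theory Num.Theory.
Import numFieldNormedType.Exports.

Local Open Scope classical_set_scope.
Local Open Scope ring_scope.

(* The sigma-algebra on row vectors is the product one, generated by the
   coordinates, as the library does for tuples; over the reals it is the Borel
   sigma-algebra of R^n. *)
Definition rV_display : measure_display -> measure_display.
Proof. exact. Qed.

Section measurable_rV.
Context {R : realType}.
Variable n : nat.

Let coord : 'I_n -> 'rV[R]_n -> measurableTypeR R := fun i v => v ord0 i.

Let rV_set0 : g_sigma_preimage coord set0.
Proof. exact: sigma_algebra0. Qed.

Let rV_setC A : g_sigma_preimage coord A -> g_sigma_preimage coord (~` A).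
Proof. exact: sigma_algebraC. Qed.

Let rV_bigcup (F : (set 'rV[R]_n)^nat) :
  (forall i, g_sigma_preimage coord (F i)) ->
  g_sigma_preimage coord (\bigcup_i (F i)).
Proof. exact: sigma_algebra_bigcup. Qed.

HB.instance Definition _ :=
  @isMeasurable.Build (rV_display default_measure_display)
  'rV[R]_n (g_sigma_preimage coord) rV_set0 rV_setC rV_bigcup.

Lemma measurable_rV_coord (i : 'I_n) : measurable_fun [set: 'rV[R]_n] (coord i).
Proof.
move=> _ Y mY; rewrite setTI; apply: sub_sigma_algebra => /=.
rewrite -bigcup_seq/=; exists i => /=; first by rewrite mem_index_enum.
by exists Y => //; rewrite setTI.
Qed.

End measurable_rV.

Section lebesgue_rV.
Context {R : realType}.

Lemma measurable_fun_rVP d (T : measurableType d) n (f : T -> 'rV[R]_n) :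
  (forall i, measurable_fun [set: T] (fun x => f x ord0 i : measurableTypeR R)) ->
  measurable_fun [set: T] f.
Proof.
pose coord (i : 'I_n) (v : 'rV[R]_n) : measurableTypeR R := v ord0 i.
move=> mf; have : g_sigma_preimage (fun i => coord i \o f) `<=` measurable.
  apply: smallest_sub; first exact: sigma_algebra_measurable.
  rewrite {}/coord; case: n => [|n] in f mf *; first by rewrite big_ord0.
  rewrite -bigcup_mkord_ord; apply: bigcup_sub => i Ii.
  by move=> A [B mB <-]; exact: mf.
rewrite (g_sigma_preimage_comp coord) => prefS.
by move=> _ A mA; apply: prefS; exists A.
Qed.

Definition rV_cons n (p : measurableTypeR R * 'rV[R]_n) : 'rV[R]_n.+1 :=
  \row_(j < n.+1) if unlift ord0 j is Some k then p.2 ord0 k else p.1.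

Definition rV_uncons n (v : 'rV[R]_n.+1) : measurableTypeR R * 'rV[R]_n :=
  (v ord0 ord0, \row_(k < n) v ord0 (lift ord0 k)).

Lemma rV_consK n : cancel (@rV_cons n) (@rV_uncons n).
Proof.
move=> [x v]; rewrite /rV_cons /rV_uncons mxE unlift_none /=; congr pair.
by apply/rowP => k; rewrite !mxE liftK.
Qed.

Lemma measurable_rV_cons n :
  measurable_fun [set: measurableTypeR R * 'rV[R]_n] (@rV_cons n).
Proof.
apply: measurable_fun_rVP => i.
rewrite /rV_cons; under eq_fun do rewrite mxE.
case: unliftP => [k _|_]; last exact: measurable_fst.
exact: (measurableT_comp (measurable_rV_coord k) measurable_snd).
Qed.

Lemma measurable_rV_uncons n :
  measurable_fun [set: 'rV[R]_n.+1] (@rV_uncons n).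
Proof.
apply/measurable_fun_pair; first exact: measurable_rV_coord.
apply: measurable_fun_rVP => i; under eq_fun do rewrite mxE.
exact: measurable_rV_coord.
Qed.

Section step.
Variables (n : nat) (m : {sigma_finite_measure set 'rV[R]_n -> \bar R}).

Definition lebesgue_rV_step : set 'rV[R]_n.+1 -> \bar R :=
  pushforward (lebesgue_measure \x m)%E (@rV_cons n).

HB.instance Definition _ := Measure.copy lebesgue_rV_step
  (measure_function_pushforward__canonical__measure_function_Measure
    (lebesgue_measure \x m)%E (@measurable_rV_cons n)).

Let lebesgue_rV_step_sigma_finite : sigma_finite setT lebesgue_rV_step.
Proof.
have /sigma_finiteP[F [TF ndF Foo]] := sigma_finiteT (@lebesgue_measure R).
have /sigma_finiteP[G [TG ndG Goo]] := sigma_finiteT m.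
exists (fun k => @rV_uncons n @^-1` (F k `*` G k)).
  rewrite -preimage_bigcup (_ : \bigcup_k _ = setT) ?preimage_setT//.
  apply/seteqP; split=> // -[x y] _.
  have [i _ Fx] : (\bigcup_k F k) x by rewrite -TF.
  have [j _ Gy] : (\bigcup_k G k) y by rewrite -TG.
  exists (maxn i j) => //; split => /=.
    by move: x Fx; exact/subsetPset/ndF/leq_maxl.
  by move: y Gy; exact/subsetPset/ndG/leq_maxr.
move=> k; have [mF Fk] := Foo k; have [mG Gk] := Goo k; split.
  rewrite -[X in measurable X]setTI; apply: measurable_rV_uncons => //.
  exact: measurableX.
rewrite /lebesgue_rV_step /pushforward -comp_preimage.
rewrite (_ : _ \o _ = id); last by apply/funext => p /=; rewrite rV_consK.
by rewrite preimage_id product_measure1E// lte_mul_pinfty// ge0_fin_numE.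
Qed.

HB.instance Definition _ := Measure_isSigmaFinite.Build _ _ _
  lebesgue_rV_step lebesgue_rV_step_sigma_finite.

End step.

(* Lebesgue measure on R^n, as an iterated product of the one on R *)
Fixpoint lebesgue_rV n : {sigma_finite_measure set 'rV[R]_n -> \bar R} :=
  if n is k.+1 then lebesgue_rV_step (lebesgue_rV k)
  else \d_(0 : 'rV[R]_0).

End lebesgue_rV.

Section euclidean.
Context {R : realType} {n : nat}.
Implicit Types (x y v : 'rV[R]_n) (A Om : set 'rV[R]_n).

(* The library norm `|x| on row vectors is the sup norm. It induces the usual
   topology, bounded sets and Lipschitz maps, but not the Euclidean distance. *)
Definition enorm v : R := Num.sqrt (\sum_(i < n) v ord0 i ^+ 2).

Definition boundary A : set 'rV[R]_n := closure A `\` interior A.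

Definition dist_boundary Om x : R :=
  inf [set enorm (x - y) | y in boundary Om].

Definition singular_set Om : set 'rV[R]_n := [set x | Om x /\
  exists y z, [/\ boundary Om y, boundary Om z, y <> z,
    enorm (x - y) = dist_boundary Om x & enorm (x - z) = dist_boundary Om x]].

(* Near each boundary point, up to an orthogonal change Q of coordinates and
   the choice i of a "vertical" coordinate, Om is the strict epigraph of a
   Lipschitz function of the n - 1 remaining coordinates. *)
Definition lipschitz_boundary Om := forall y, boundary Om y ->
  exists (r : R) (Q : 'M[R]_n) (i : 'I_n) (g : 'rV[R]_n.-1 -> R) (L : R),
    [/\ 0 < r, Q *m Q^T = 1%:M, L.-lipschitz g &
      forall x, enorm (x - y) < r ->
        (Om x <-> g (col' i (x *m Q)) < (x *m Q) ord0 i)].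

(* Hausdorff measure of integer dimension s > 0, without normalising constant *)
Definition ediam A : \bar R :=
  ereal_sup (0%E |` [set (enorm (p.1 - p.2))%:E | p in A `*` A]).

Definition hausdorff_pre (s : nat) (d : R) A : \bar R :=
  ereal_inf [set (\sum_(0 <= k <oo) ediam (F k) ^+ s)%E |
    F in [set F : (set 'rV[R]_n)^nat |
      A `<=` \bigcup_k F k /\ forall k, (ediam (F k) <= d%:E)%E]].

Definition hausdorff (s : nat) A : \bar R :=
  ereal_sup [set hausdorff_pre s d A | d in [set d : R | 0 < d]].

End euclidean.

Section sobolev.
Context {R : realType} {n : nat}.
Local Notation mu := (@lebesgue_rV R n).
Implicit Types (Om : set 'rV[R]_n) (u f phi psi t : 'rV[R]_n -> R).

(* Functions on Om are represented by functions on the whole space whose values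
   outside Om are irrelevant. *)
Definition Linfty Om u : Prop := u \_ Om \in Lfun mu +oo%E.

Definition Linfty_norm Om u : \bar R := Lnorm mu +oo%E (EFin \o (u \_ Om)).

(* L^oo norm on the boundary, for the surface measure H^(n-1) *)
Definition Linfty_norm_boundary Om t : \bar R :=
  ereal_inf [set M : \bar R | (0 <= M)%E /\
    hausdorff n.-1 [set y | boundary Om y /\ (M < `|t y|%:E)%E] = 0%E].

Definition partial (i : 'I_n) u : 'rV[R]_n -> R :=
  fun x => 'D_(delta_mx ord0 i) u x.

Definition smooth u := forall s : seq 'I_n,
  continuous (foldr partial u s) /\
  forall x i, derivable (foldr partial u s) x (delta_mx ord0 i).

Definition test_function Om psi :=
  [/\ smooth psi, compact (closure [set x | psi x != 0]) &
      closure [set x | psi x != 0] `<=` Om].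

Definition weak_gradient Om u (G : 'rV[R]_n -> 'rV[R]_n) :=
  forall (i : 'I_n) psi, test_function Om psi ->
    (\int[mu]_(x in Om) (u x * partial i psi x) =
     - \int[mu]_(x in Om) (G x ord0 i * psi x))%R.

(* u belongs to W^{1,oo}(Om), with gradient G (determined up to a null set) *)
Definition W1infty Om u (G : 'rV[R]_n -> 'rV[R]_n) :=
  [/\ Linfty Om u, forall i, Linfty Om (fun x => G x ord0 i) &
      weak_gradient Om u G].

(* On a bounded Lipschitz domain, elements of W^{1,oo} are continuous up to the
   boundary, and the trace is the restriction to the boundary of the continuous
   representative; only the values of t on the boundary are used as a trace. *)
Definition has_trace Om u t :=
  {within closure Om, continuous t} /\
  {ae mu, forall x, Om x -> t x = u x}.

Definition admissible Om (beta : R) phi :=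
  exists (G : 'rV[R]_n -> 'rV[R]_n) t,
    [/\ W1infty Om phi G, (Linfty_norm Om (enorm \o G) <= 1)%E,
        has_trace Om phi t &
        (beta%:E * Linfty_norm_boundary Om t <= 1)%E].

Definition J_infty Om f phi : R :=
  (- \int[mu]_(x in Om) (f x * phi x))%R.

(* "Unique" is meant among functions identified when equal a.e. on Om. *)
Definition unique_minimizer Om (K : ('rV[R]_n -> R) -> Prop)
    (J : ('rV[R]_n -> R) -> R) v :=
  [/\ K v, forall phi, K phi -> J v <= J phi &
      forall phi, K phi -> (forall psi, K psi -> J phi <= J psi) ->
        {ae mu, forall x, Om x -> phi x = v x}].

Definition ess_support Om f : set 'rV[R]_n :=
  ~` \bigcup_(U in [set U | open U /\
        {ae mu, forall x, Om x -> U x -> f x = 0}]) U.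

Definition v_infty Om (beta : R) : 'rV[R]_n -> R :=
  fun x => beta^-1 + dist_boundary Om x.

End sobolev.

(* Main.v *)
(* Write d for the distance to the boundary and v = 1/beta + d. An admissible phi
   has a continuous representative t which is 1-Lipschitz on balls of Om, and
   |t| <= 1/beta on the whole boundary, because relatively open pieces of a
   Lipschitz boundary have positive H^(n-1) measure. Walking to the nearest
   boundary point gives t <= v, so v is a minimizer since f >= 0.

   If J phi = J v, then t = v on Supp f. For x in Om and lam < 1 a maximizer w of
   d - lam |. - x| is singular; if R is contained in Supp f then t(w) = v(w) and
   t(x) >= v(w) - |w - x| >= v(x) - (1 - lam) |w - x|, since x lies in the ball
   B(w, d(w)) for lam close to 1. Let lam tend to 1.

   Conversely, let x0 in R have a neighbourhood on which f = 0. Having two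
   nearest boundary points, d stays strictly below the cone d(x0) + |. - x0|
   away from x0; hence truncating d by a lowered, rounded cone yields an
   admissible function that differs from v near x0 only, with the same J.

   That v and its truncation belong to W^{1,oo} is shown without Rademacher's
   theorem: d^2 - |.|^2 is an infimum of affine functions, so d has one-sided
   directional derivatives everywhere in Om, and integration by parts shows that
   opposite ones cancel almost everywhere. *)

Require Import Defs.
From mathcomp Require Import all_boot all_order all_algebra.
From mathcomp Require Import all_classical all_reals all_analysis.
From mathcomp Require Import measurable_realfun ess_sup_inf.
From mathcomp Require Import lra ring.

Set Implicit Arguments.
Unset Strict Implicit.
Unset Printing Implicit Defensive.

Import Order.TTheory GRing.Theory Num.Theory.
Import numFieldNormedType.Exports.

Local Open Scope classical_set_scope.
Local Open Scope ring_scope.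

(** * Lebesgue measure on row vectors *)

Section measure_rV.
Context {R : realType}.
Implicit Types n : nat.

(** The obstacle is that [admissible] asks for a weak gradient of Euclidean norm at most 1 almost
    everywhere, whereas bounding every partial derivative by 1 would only give the square root of n.
    Hence the notion [tame]: besides one-sided derivatives it carries one vector [q] of norm at most
    1 whose linear form dominates all of them. Opposite one-sided derivatives then have a
    nonpositive sum; once a weighted integral of this sum is shown to vanish, the partial
    derivatives are almost everywhere the coordinates of [q]. The truncating cone is rounded because
    |. - x0| admits no such [q] at its vertex. For v and its truncation, integration by parts comes
    from translation invariance of Lebesgue measure applied to difference quotients. On the side of
    a general admissible function, Om need be neither convex nor connected, so the Lipschitz bound
    on the trace is only used inside balls B(x, d(x)), which lie in Om. *)

Lemma normr_rV_le n (v : 'rV[R]_n) r :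
  0 <= r -> (`|v| <= r) = [forall i, `|v ord0 i| <= r].
Proof.
move=> r0; rewrite [leLHS]/Num.norm/= mx_normrE; apply/idP/forallP => [h i|h].
  by apply: le_trans h; apply/bigmax_geP; right; exists (ord0, i).
by apply/bigmax_leP; split=> // -[j i] _ /=; rewrite ord1.
Qed.

Lemma measurable_cube n (c : 'rV[R]_n) (r : R) :
  measurable [set v : 'rV[R]_n | forall i, `|v ord0 i - c ord0 i| <= r].
Proof.
rewrite (_ : mkset _ = \bigcap_(i in [set: 'I_n])
    ((fun v : 'rV[R]_n => v ord0 i : measurableTypeR R) @^-1`
       [set x | `|x - c ord0 i| <= r])); last first.
  by apply/seteqP; split=> v /= h i; first move=> _; exact: h.
apply: fin_bigcap_measurable; first exact: finite_finset.
move=> i _; rewrite -[X in measurable X]setTI; apply: measurable_rV_coord => //.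
rewrite (_ : mkset _ = `[c ord0 i - r, c ord0 i + r]%classic); last first.
  by apply/seteqP; split=> x /=; rewrite in_itv/= ler_distl.
exact: measurable_itv.
Qed.

(** The sigma-algebra is generated by coordinates, not by open sets. An open set is the union of the
    closed cubes with rational centre and radius 1/(k+1) that it contains, and there are countably
    many of these. *)
Lemma measurable_open_rV n (A : set 'rV[R]_n) : open A -> measurable A.
Proof.
move=> oA.
pose cube (q : 'rV[rat]_n) (k : nat) : set 'rV[R]_n :=
  [set v | forall i, `|v ord0 i - (map_mx ratr q : 'rV[R]_n) ord0 i| <= k.+1%:R^-1].
rewrite (_ : A = \bigcup_(p in [set p : 'rV[rat]_n * nat | cube p.1 p.2 `<=` A])
                   cube p.1 p.2).
  rewrite bigcup_mkcond; apply: countable_bigcupT_measurable => [|p].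
    exact: countableP.
  by case: ifPn => // _; exact: measurable_cube.
apply/seteqP; split; last by move=> x [p /= pA]; exact: pA.
move=> x Ax; have /nbhs_ballP[e e0 eA] := open_nbhs_nbhs (conj oA Ax).
have [k ke] : exists k : nat, k.+1%:R^-1 < e / 2.
  have e20 : 0 < e / 2 by rewrite divr_gt0.
  have [k _ /(_ k (leqnn k))/= h] := near_infty_natSinv_lt (PosNum e20).
  by exists k.
have q_ i : exists q : rat, `|x ord0 i - ratr q| < k.+1%:R^-1.
  have : x ord0 i - k.+1%:R^-1 < x ord0 i + k.+1%:R^-1.
    by rewrite ltrD2l gt0_cp// invr_gt0.
  by move=> /rat_in_itvoo[q]; rewrite in_itv/= => h; exists q; rewrite ltr_distlC.
have /choice[q qP] := q_.
exists (\row_i q i, k) => /=; last first.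
  by move=> i; rewrite !mxE ltW.
move=> v vc; apply: eA; rewrite -ball_normE/=.
apply: (@le_lt_trans _ _ (k.+1%:R^-1 + k.+1%:R^-1)); first last.
  by rewrite [ltRHS]splitr; apply: ltrD.
rewrite normr_rV_le ?addr_ge0//; apply/forallP => i; rewrite !mxE.
rewrite (_ : _ - _ = (x ord0 i - ratr (q i)) - (v ord0 i - ratr (q i))); last by ring.
apply: (le_trans (ler_normB _ _)); apply: lerD; first exact/ltW.
by have := vc i; rewrite !mxE.
Qed.

Lemma continuous_measurable_rV n (A : set 'rV[R]_n) (f : 'rV[R]_n -> R) :
  open A -> {in A, continuous f} -> measurable_fun A f.
Proof.
move=> oA cf; apply: (measurability _ (RGenOpens.measurableE R)).
move=> _ [_ [a [b ->]] <-]; apply: measurable_open_rV; rewrite openE => x [Ax fx].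
apply: filterI; first exact: open_nbhs_nbhs.
apply: (cf x); first by rewrite inE.
by apply: open_nbhs_nbhs; split => //; exact: interval_open.
Qed.

Let shift1 (a : R) (x : measurableTypeR R) : measurableTypeR R := x + a.

Let measurable_shift1 a : measurable_fun setT (shift1 a).
Proof. by apply: measurable_funD. Qed.

Lemma lebesgue_measure_shift (a : R) (A : set (measurableTypeR R)) :
  measurable A -> lebesgue_measure [set x : R | A (x + a)] = lebesgue_measure A.
Proof.
move=> mA; apply/esym.
have := @lebesgue_measure_unique R
  (measure_function_pushforward__canonical__measure_function_Measure
    (@lebesgue_measure R) (measurable_shift1 a)); apply => // X [[x y] _ <-].
rewrite /= /pushforward (_ : _ @^-1` _ = `]x - a, y - a]%classic).
  rewrite !lebesgue_measure_itv/= !lte_fin ltrD2r.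
  by case: ifPn => // xy; rewrite -!EFinB; congr EFin; ring.
by apply/seteqP; split => z /=; rewrite /shift1 !in_itv/= ltrBlDr lerBrDr.
Qed.

Lemma measurable_shift_rV n (a : 'rV[R]_n) :
  measurable_fun setT (fun x : 'rV[R]_n => x + a).
Proof.
apply: measurable_fun_rVP => i; under eq_fun do rewrite mxE.
by apply: measurable_funD => //; exact: measurable_rV_coord.
Qed.

(** By induction on n: the translated product measure agrees with the original one on rectangles,
    which determine a product of sigma-finite measures. *)
Lemma lebesgue_rV_shift n (a : 'rV[R]_n) (A : set 'rV[R]_n) :
  measurable A -> lebesgue_rV n [set x | A (x + a)] = lebesgue_rV n A.
Proof.
elim: n a A => [|n IH] a A mA.
  by congr (_ _); apply/seteqP; split=> x /=; rewrite (thinmx0 a) addr0.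
rewrite /= /lebesgue_rV_step /pushforward.
set B := @rV_cons R n @^-1` A.
pose a' := @rV_uncons R n a.
have mB : measurable B.
  rewrite -[X in measurable X]setTI; exact: measurable_rV_cons.
pose sh (p : measurableTypeR R * 'rV[R]_n) : measurableTypeR R * 'rV[R]_n :=
   (p.1 + a'.1, p.2 + a'.2).
have msh : measurable_fun setT sh.
  apply/measurable_fun_pair.
    by apply: measurable_funD => //; exact: measurable_fst.
  apply: (measurableT_comp (measurable_shift_rV a'.2)); exact: measurable_snd.
rewrite (_ : _ @^-1` [set x | A (x + a)] = sh @^-1` B); last first.
  rewrite /B -comp_preimage -[LHS]/((fun p => rV_cons p + a) @^-1` A); congr (_ @^-1` A).
  apply/funext => -[x v] /=; apply/rowP => j; rewrite !mxE.
  by case: unliftP => [k ->|->]; rewrite /= ?mxE.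
have := @product_measure_unique _ _ _ _ _ (@lebesgue_measure R) (lebesgue_rV n)
  (measure_function_pushforward__canonical__measure_function_Measure
    (@lebesgue_measure R \x lebesgue_rV n)%E msh).
move=> uniq; apply/esym; apply: uniq => // X Y mX mY.
rewrite /= /pushforward (_ : _ @^-1` _ = [set x : R | X (x + a'.1)] `*` [set v | Y (v + a'.2)]).
  rewrite product_measure1E.
  - rewrite IH//; congr (_ * _)%E; exact: lebesgue_measure_shift.
  - rewrite -[X in measurable X]setTI; exact: measurable_shift1.
  - rewrite -[X in measurable X]setTI; exact: measurable_shift_rV.
by [].
Qed.

Lemma lebesgue_rV_cube n (c : 'rV[R]_n) (r : R) : 0 <= r ->
  lebesgue_rV n [set v : 'rV[R]_n | forall i, `|v ord0 i - c ord0 i| <= r] =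
  ((2 * r) ^+ n)%:E.
Proof.
move=> r0; elim: n c => [|n IH] c.
  by rewrite /= diracE mem_set//= => -[].
rewrite /= /lebesgue_rV_step /pushforward.
rewrite (_ : _ @^-1` _ = `[c ord0 ord0 - r, c ord0 ord0 + r]%classic `*`
  [set v : 'rV[R]_n | forall i, `|v ord0 i - (@rV_uncons R n c).2 ord0 i| <= r]).
  rewrite product_measure1E//; last exact: measurable_cube.
  rewrite IH -[X in (X * _)%E]/(lebesgue_measure `[c ord0 ord0 - r, c ord0 ord0 + r]%classic).
  rewrite lebesgue_measure_itv/= lte_fin.
  case: ifPn => [_|]; first by rewrite -EFinB -EFinM exprS; congr EFin; ring.
  rewrite -leNgt => h; have -> : r = 0 by lra.
  by rewrite mul0e mulr0 exprS mul0r.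
apply/seteqP; split=> -[x v] /=; rewrite /rV_cons/= in_itv/= -ler_distl.
  move=> h; split; first by have := h ord0; rewrite mxE unlift_none.
  by move=> i; have := h (lift ord0 i); rewrite !mxE liftK.
move=> [h1 h2] i; rewrite mxE; case: unliftP => [k ->|->] //=.
by have := h2 k; rewrite mxE.
Qed.

End measure_rV.

(** * Euclidean norm and distance to the boundary *)

Section euclid.
Context {R : realType}.
Implicit Types n : nat.

Definition dot n (x y : 'rV[R]_n) : R := \sum_(i < n) x ord0 i * y ord0 i.

Lemma dotC n (x y : 'rV[R]_n) : dot x y = dot y x.
Proof. by apply: eq_bigr => i _; rewrite mulrC. Qed.

Lemma dotDl n (x y z : 'rV[R]_n) : dot (x + y) z = dot x z + dot y z.
Proof. by rewrite -big_split/=; apply: eq_bigr => i _; rewrite mxE mulrDl. Qed.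

Lemma dotZl n (a : R) (x y : 'rV[R]_n) : dot (a *: x) y = a * dot x y.
Proof. by rewrite mulr_sumr; apply: eq_bigr => i _; rewrite mxE mulrA. Qed.

Lemma dotNl n (x y : 'rV[R]_n) : dot (- x) y = - dot x y.
Proof. by rewrite -scaleN1r dotZl mulN1r. Qed.

Lemma dotDr n (x y z : 'rV[R]_n) : dot x (y + z) = dot x y + dot x z.
Proof. by rewrite dotC dotDl !(dotC x). Qed.

Lemma dotZr n (a : R) (x y : 'rV[R]_n) : dot x (a *: y) = a * dot x y.
Proof. by rewrite dotC dotZl dotC. Qed.

Lemma dotNr n (x y : 'rV[R]_n) : dot x (- y) = - dot x y.
Proof. by rewrite dotC dotNl dotC. Qed.

Definition dotE := (dotDl, dotDr, dotNl, dotNr, dotZl, dotZr).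

Lemma dot_ge0 n (x : 'rV[R]_n) : 0 <= dot x x.
Proof. by apply: sumr_ge0 => i _; rewrite -expr2 sqr_ge0. Qed.

Lemma enormE n (x : 'rV[R]_n) : enorm x = Num.sqrt (dot x x).
Proof. by congr Num.sqrt; apply: eq_bigr => i _; rewrite expr2. Qed.

Lemma enorm_ge0 n (x : 'rV[R]_n) : 0 <= enorm x.
Proof. exact: sqrtr_ge0. Qed.

Lemma sqr_enorm n (x : 'rV[R]_n) : enorm x ^+ 2 = dot x x.
Proof. by rewrite enormE sqr_sqrtr// dot_ge0. Qed.

Lemma coord_le_enorm n (x : 'rV[R]_n) i : `|x ord0 i| <= enorm x.
Proof.
rewrite -sqrtr_sqr ler_wsqrtr// (bigD1 i)//= lerDl.
by apply: sumr_ge0 => j _; exact: sqr_ge0.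
Qed.

Lemma normr_le_enorm n (x : 'rV[R]_n) : `|x| <= enorm x.
Proof.
by rewrite normr_rV_le ?enorm_ge0//; apply/forallP => i; exact: coord_le_enorm.
Qed.

Lemma dot_eq0 n (x : 'rV[R]_n) : dot x x = 0 -> x = 0.
Proof.
move=> /eqP; rewrite psumr_eq0 => [/allP h|i _]; last by rewrite -expr2 sqr_ge0.
apply/rowP => i; rewrite mxE; apply/eqP.
by have := h i (mem_index_enum _); rewrite /= mulf_eq0 orbb.
Qed.

Lemma enorm_eq0 n (x : 'rV[R]_n) : enorm x = 0 -> x = 0.
Proof. by move=> h; apply: dot_eq0; rewrite -sqr_enorm h expr0n. Qed.

Lemma enorm0 n : enorm (0 : 'rV[R]_n) = 0.
Proof. by rewrite enormE -(scale0r 0) dotZl mul0r sqrtr0. Qed.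

Lemma enorm_gt0 n (x : 'rV[R]_n) : x != 0 -> 0 < enorm x.
Proof.
move=> x0; rewrite lt_def enorm_ge0 andbT; apply: contra x0 => /eqP h.
by apply/eqP; exact: enorm_eq0.
Qed.

Lemma enormZ n (a : R) (x : 'rV[R]_n) : enorm (a *: x) = `|a| * enorm x.
Proof.
by rewrite !enormE dotZl dotZr mulrA sqrtrM -?expr2 ?sqr_ge0// sqrtr_sqr.
Qed.

Lemma enormN n (x : 'rV[R]_n) : enorm (- x) = enorm x.
Proof. by rewrite -scaleN1r enormZ normrN1 mul1r. Qed.

Lemma enorm_distC n (x y : 'rV[R]_n) : enorm (x - y) = enorm (y - x).
Proof. by rewrite -opprB enormN. Qed.

Lemma cauchy_schwarz n (x y : 'rV[R]_n) : dot x y <= enorm x * enorm y.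
Proof.
have [->|y0] := eqVneq y 0.
  by rewrite enorm0 mulr0 -(scale0r 0) dotZr mul0r.
have yp : 0 < dot y y by rewrite -sqr_enorm exprn_gt0// enorm_gt0.
(* This squared norm is |y|^2 times the Cauchy-Schwarz defect |x|^2 |y|^2 - (x.y)^2. *)
have := dot_ge0 (dot y y *: x - dot x y *: y).
rewrite !dotE (dotC y x) => h.
have {}h : 0 <= dot y y * (dot x x * dot y y - dot x y ^+ 2).
  by apply: le_trans h _; rewrite le_eqVlt; apply/orP; left; apply/eqP; ring.
rewrite pmulr_rge0// subr_ge0 in h.
apply: (le_trans (ler_norm _)); rewrite -(@ler_pXn2r _ 2)// ?nnegrE//.
  by rewrite -normrX ger0_norm ?sqr_ge0// exprMn !sqr_enorm.
by rewrite mulr_ge0// enorm_ge0.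
Qed.

Lemma enormD n (x y : 'rV[R]_n) : enorm (x + y) <= enorm x + enorm y.
Proof.
rewrite -(@ler_pXn2r _ 2)// ?nnegrE ?addr_ge0 ?enorm_ge0//.
rewrite sqr_enorm sqrrD !sqr_enorm !dotE (dotC y x).
have := cauchy_schwarz x y; lra.
Qed.

Lemma enorm_triangle n (z x y : 'rV[R]_n) :
  enorm (x - y) <= enorm (x - z) + enorm (z - y).
Proof. by have <- := subrKA z x (- y); exact: enormD. Qed.

Lemma enorm_delta n (i : 'I_n) : enorm (delta_mx ord0 i : 'rV[R]_n) = 1.
Proof.
rewrite enormE /dot (bigD1 i)//= big1 ?addr0 => [|j ji].
  by rewrite !mxE !eqxx mulr1 sqrtr1.
by rewrite !mxE eqxx (negbTE ji) mulr0.
Qed.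

Lemma dot_delta n (i : 'I_n) (x : 'rV[R]_n) : dot x (delta_mx ord0 i) = x ord0 i.
Proof.
rewrite /dot (bigD1 i)//= big1 ?addr0 => [|j ji].
  by rewrite !mxE !eqxx mulr1.
by rewrite !mxE eqxx (negbTE ji) mulr0.
Qed.

Lemma enorm_le_normr n (x : 'rV[R]_n) : enorm x <= n%:R * `|x|.
Proof.
rewrite -(@ler_pXn2r _ 2)// ?nnegrE ?mulr_ge0 ?enorm_ge0//.
rewrite sqr_enorm exprMn.
have -> : n%:R ^+ 2 * `|x| ^+ 2 = \sum_(i < n) n%:R * `|x| ^+ 2 :> R.
  by rewrite sumr_const card_ord -mulr_natl; ring.
apply: ler_sum => i _; have n1 : (1 <= n%:R :> R).
  by rewrite ler1n; case: n i {x} => // -[].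
apply: (@le_trans _ _ (`|x| ^+ 2)); last first.
  by rewrite ler_peMl// exprn_ge0.
rewrite -expr2 -[leLHS]ger0_norm ?sqr_ge0// normrX lerXn2r// ?nnegrE//.
by have := lexx `|x|; rewrite normr_rV_le// => /forallP.
Qed.

(** One-sided, since x and y may be exchanged; this form is the one that infima satisfy directly. *)
Definition lip1 n (u : 'rV[R]_n -> R) := forall x y, u x - u y <= enorm (x - y).

Lemma lip1_norm n (u : 'rV[R]_n -> R) x y : lip1 u -> `|u x - u y| <= enorm (x - y).
Proof. by move=> h; rewrite ler_norml lerNl opprB h enorm_distC h. Qed.

Lemma lip1_continuous n (u : 'rV[R]_n -> R) : lip1 u -> continuous u.
Proof.
move=> lu x; apply/(@cvgrPdist_lt _ _ _ _ (nbhs_filter x)) => e e0.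
(* Comparing the two norms with n + 1 instead of n keeps the constant positive when n = 0. *)
have n0 : 0 < n.+1%:R :> R by [].
apply/nbhs_ballP; exists (e / n.+1%:R) => /=; first by rewrite divr_gt0.
move=> y; rewrite -ball_normE/= => xy.
apply: (le_lt_trans (lip1_norm _ _ lu)); apply: (le_lt_trans (enorm_le_normr _)).
apply: (@le_lt_trans _ _ (n.+1%:R * `|x - y|)); first by rewrite ler_wpM2r// ler_nat.
by rewrite mulrC -ltr_pdivlMr.
Qed.

Lemma lip1_enorm n (p : 'rV[R]_n) : lip1 (fun x => enorm (x - p)).
Proof. by move=> x y; rewrite lerBlDr; exact: enorm_triangle. Qed.

Lemma lip1B n (u : 'rV[R]_n -> R) (c : R) : lip1 u -> lip1 (fun x => c + u x).
Proof. by move=> lu x y; rewrite opprD addrACA subrr add0r. Qed.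

Lemma lip1_min n (u v : 'rV[R]_n -> R) :
  lip1 u -> lip1 v -> lip1 (fun x => Num.min (u x) (v x)).
Proof.
move=> lu lv x y /=; rewrite lerBlDr addrC -lerBlDr le_min !lerBlDr.
have := lu x y; have := lv x y => h1 h2.
apply/andP; split.
  by apply: (@le_trans _ _ (u x)); [exact: ge_min_l || by rewrite ge_min lexx|lra].
by apply: (@le_trans _ _ (v x)); [by rewrite ge_min lexx orbT|lra].
Qed.

Lemma open_enorm_ball n (x : 'rV[R]_n) (r : R) : open [set y | enorm (y - x) < r].
Proof.
have /continuousP/(_ [set z | z < r]) := lip1_continuous (lip1_enorm x).
by apply; exact: open_lt.
Qed.

Lemma open_enormP n (U : set 'rV[R]_n) x : open U -> U x ->
  exists2 r : R, 0 < r & forall y, enorm (y - x) < r -> U y.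
Proof.
move=> oU Ux; have /nbhs_ballP[e e0 eU] := open_nbhs_nbhs (conj oU Ux).
exists e => // y xy; apply: eU; rewrite -ball_normE/= distrC.
exact: le_lt_trans (normr_le_enorm _) xy.
Qed.

Lemma bounded_enorm n (A : set 'rV[R]_n) : bounded_set A ->
  exists2 M : R, 0 < M & forall x, A x -> enorm x <= M.
Proof.
move=> /ex_strict_bound_gt0[M /= M0 AM].
exists (n.+1%:R * M); first by rewrite mulr_gt0.
move=> x /AM/= xM; apply: (le_trans (enorm_le_normr _)).
by apply: ler_pM => //; [rewrite ler_nat|exact: ltW].
Qed.

End euclid.

(** * Distance to the boundary of a bounded open set *)

Section distance.
Context {R : realType} {n : nat}.
Implicit Types (Om : set 'rV[R]_n) (x y z : 'rV[R]_n).

Lemma closed_boundary Om : closed (boundary Om).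
Proof.
rewrite /boundary setDE; apply: closedI; first exact: closed_closure.
by apply: open_closedC; exact: open_interior.
Qed.

Lemma boundary_openE Om : open Om -> boundary Om = closure Om `\` Om.
Proof. by move=> /interior_id; rewrite /boundary => ->. Qed.

Lemma bounded_closure Om : bounded_set Om -> bounded_set (closure Om).
Proof.
move=> /ex_strict_bound_gt0[M M0 h].
rewrite /bounded_set /bounded_near; near=> N; move=> x /= clx.
have [y [Omy]] := clx _ (nbhsx_ballx x 1 ltr01).
rewrite -ball_normE/= => xy.
rewrite -(subrK y x); apply: (le_trans (ler_normD _ _)).
apply: (@le_trans _ _ (1 + M)); first by apply: lerD; apply: ltW => //; exact: h.
by near: N; apply: nbhs_pinfty_ge; rewrite num_real.
Unshelve. all: by end_near. Qed.

Lemma compact_closure Om : bounded_set Om -> compact (closure Om).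
Proof.
move=> bO; apply: bounded_closed_compact; first exact: bounded_closure.
exact: closed_closure.
Qed.

Lemma compact_boundary Om : bounded_set Om -> compact (boundary Om).
Proof.
move=> bO; apply: (subclosed_compact (closed_boundary (Om := Om)) (compact_closure bO)).
exact: subDsetl.
Qed.

Lemma continuous_line x y : continuous (fun s : R => x + s *: (y - x)).
Proof.
by move=> s; apply: cvgD; [exact: cvg_cst|apply: cvgZl; exact: cvg_id].
Qed.

(** If the segment avoided the boundary, the parameters whose point lies in Om would form a nonempty
    subset both open and closed in [0, 1], hence all of it, and z would be in Om. *)
Lemma segment_boundary Om x z : open Om -> Om x -> ~ Om z ->
  exists2 s : R, 0 <= s <= 1 & boundary Om (x + s *: (z - x)).
Proof.
move=> oO Ox Oz; apply: contrapT => nob.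
pose g (s : R) := x + s *: (z - x).
have cg : continuous g := @continuous_line x z.
have c01 := @segment_connected R 0 1.
pose B := `[0, 1]%classic `&` g @^-1` Om.
have /seteqP[_ /(_ 1)] : B = `[0, 1]%classic.
  apply: c01.
  - by exists 0; split=> /=; rewrite ?in_itv/= ?lexx ?ler01 /g ?scale0r ?addr0.
  - exists (g @^-1` Om) => //.
    by move/continuousP : cg; apply.
  - exists (g @^-1` closure Om).
      by move/continuous_closedP : cg; apply; exact: closed_closure.
    apply/seteqP; split=> s [s01 gs]; split => //; first exact: subset_closure.
    apply: contrapT => gsO; apply: nob; exists s.
      by move: s01; rewrite /= in_itv.
    by rewrite boundary_openE.
rewrite /B /= in_itv/= ler01 lexx => /(_ isT)[_].
by rewrite /g scale1r addrC subrK.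
Qed.

Lemma boundary_nonempty Om x : (0 < n)%N -> open Om -> bounded_set Om -> Om x ->
  boundary Om !=set0.
Proof.
move=> n0 oO /bounded_enorm[M M0 OM] Ox.
(* Om lies in the ball of radius M, so this point is outside and the segment to it must cross the
   boundary. *)
pose z : 'rV[R]_n := (2 * M) *: delta_mx ord0 (Ordinal n0).
have Oz : ~ Om z.
  move=> /OM; rewrite enormZ enorm_delta mulr1 ger0_norm; lra.
by have [s _ bs] := segment_boundary oO Ox Oz; exists (x + s *: (z - x)).
Qed.

Section fixed.
Variable Om : set 'rV[R]_n.
Hypothesis bne : boundary Om !=set0.
Local Notation d := (dist_boundary Om).

Let has_inf_dist x : has_inf [set enorm (x - y) | y in boundary Om].
Proof.
split; first by have [y bdy] := bne; exists (enorm (x - y)); exists y.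
by exists 0 => _ [y _ <-]; exact: enorm_ge0.
Qed.

Lemma dist_le x y : boundary Om y -> d x <= enorm (x - y).
Proof.
by move=> bdy; apply: ge_inf; [exact: (has_inf_dist x).2|exists y].
Qed.

Lemma le_dist x r : (forall y, boundary Om y -> r <= enorm (x - y)) -> r <= d x.
Proof.
move=> h; apply: lb_le_inf; first exact: (has_inf_dist x).1.
by move=> _ [y bdy <-]; exact: h.
Qed.

Lemma dist_ge0 x : 0 <= d x.
Proof. by apply: le_dist => y _; exact: enorm_ge0. Qed.

Lemma lip1_dist : lip1 d.
Proof.
move=> x y; rewrite lerBlDr addrC -lerBlDr; apply: le_dist => z bz.
by rewrite lerBlDl; apply: le_trans (dist_le _ bz) _; exact: enorm_triangle.
Qed.

Lemma dist_boundary0 y : boundary Om y -> d y = 0.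
Proof.
move=> bdy; apply/eqP; rewrite eq_le dist_ge0 andbT.
by apply: le_trans (dist_le _ bdy) _; rewrite subrr enorm0.
Qed.

Hypotheses (oO : open Om) (bO : bounded_set Om).

Lemma dist_attained x : exists2 y, boundary Om y & enorm (x - y) = d x.
Proof.
have [y] := compact_EVT_min bne (compact_boundary bO)
  (continuous_subspaceT (lip1_continuous (lip1_enorm x))).
rewrite inE => bdy hy; exists y => //; apply/eqP.
rewrite eq_le dist_le// andbT; apply: le_dist => z bz.
by rewrite !(enorm_distC x); apply: hy; rewrite inE.
Qed.

(** Otherwise the segment from x to z would meet the boundary at distance less than d x from x. *)
Lemma dist_ball x z : Om x -> enorm (z - x) < d x -> Om z.
Proof.
move=> Ox xz; apply: contrapT => Oz.
have [s /andP[s0 s1] /(dist_le x)] := segment_boundary oO Ox Oz.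
rewrite opprD addrA subrr add0r enormN enormZ ger0_norm// leNgt => /negP; apply.
by apply: le_lt_trans xz; rewrite ler_piMl// enorm_ge0.
Qed.

Lemma dist_gt0 x : Om x -> 0 < d x.
Proof.
move=> Ox; rewrite lt_def dist_ge0 andbT; apply/negP => /eqP dx0.
have [y bdy] := dist_attained x; rewrite dx0 => /enorm_eq0/eqP.
rewrite subr_eq0 => /eqP xy; move: bdy; rewrite -xy boundary_openE//.
by case.
Qed.

End fixed.
End distance.

(** * The singular set *)

Section continuous_pointwise.
Context {R : realType} {T : topologicalType}.
Implicit Types f g : T -> R.

Lemma continuous_subr f g :
  continuous f -> continuous g -> continuous (fun x => f x - g x).
Proof. by move=> cf cg x; exact: (continuousB (cf x) (cg x)). Qed.

Lemma continuous_addr f g :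
  continuous f -> continuous g -> continuous (fun x => f x + g x).
Proof. by move=> cf cg x; exact: (continuousD (cf x) (cg x)). Qed.

Lemma continuous_mulr f g :
  continuous f -> continuous g -> continuous (fun x => f x * g x).
Proof. by move=> cf cg x; exact: (continuousM (cf x) (cg x)). Qed.

Lemma continuous_sumr (I : Type) (s : seq I) (F : I -> T -> R) :
  (forall i, continuous (F i)) -> continuous (fun x => \sum_(i <- s) F i x).
Proof.
move=> cF; elim: s => [|i s IH].
  by under eq_fun do rewrite big_nil; exact: cst_continuous.
by under eq_fun do rewrite big_cons; exact: continuous_addr.
Qed.

Lemma continuous_prodr (I : Type) (s : seq I) (F : I -> T -> R) :
  (forall i, continuous (F i)) -> continuous (fun x => \prod_(i <- s) F i x).
Proof.
move=> cF; elim: s => [|i s IH].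
  by under eq_fun do rewrite big_nil; exact: cst_continuous.
by under eq_fun do rewrite big_cons; exact: continuous_mulr.
Qed.

End continuous_pointwise.

Section climb.
Context {R : realType} {n : nat}.
Implicit Types (Om : set 'rV[R]_n) (x y z : 'rV[R]_n).

Variable Om : set 'rV[R]_n.
Hypotheses (bne : boundary Om !=set0) (oO : open Om) (bO : bounded_set Om).
Local Notation d := (dist_boundary Om).

(* A maximizer of [d - lam |. - x0|] is singular: at a point with a unique
   nearest boundary point the distance grows with slope 1 > lam. *)
Lemma singular_climb x0 (lam : R) : Om x0 -> 0 <= lam < 1 ->
  exists2 w, singular_set Om w & d x0 + lam * enorm (w - x0) <= d w.
Proof.
move=> Ox0 /andP[lam0 lam1].
pose F w := d w - lam * enorm (w - x0).
have cF : continuous F.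
  apply: continuous_subr; first exact: (lip1_continuous (lip1_dist bne)).
  apply: continuous_mulr; first exact: cst_continuous.
  exact: (lip1_continuous (lip1_enorm x0)).
have [w] := compact_EVT_max (ex_intro _ x0 (subset_closure Ox0))
  (compact_closure bO) (continuous_subspaceT cF).
rewrite inE => clw maxw.
have {}maxw z : Om z -> F z <= F w.
  by move=> Oz; apply: maxw; rewrite inE; exact: subset_closure.
have dw : d x0 + lam * enorm (w - x0) <= d w.
  by have := maxw x0 Ox0; rewrite /F subrr enorm0 mulr0 subr0 lerBrDr.
exists w => //.
have dx0 := dist_gt0 bne oO bO Ox0.
have dw0 : 0 < d w.
  by apply: lt_le_trans dx0 (le_trans _ dw); rewrite lerDl mulr_ge0// enorm_ge0.
(* The maximizer was sought in the closure of Om; d w >= d x0 > 0 keeps it off the boundary. *)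
have Ow : Om w.
  apply: contrapT => nOw; suff : d w = 0 by move=> dw00; rewrite dw00 ltxx in dw0.
  by apply: dist_boundary0 => //; rewrite boundary_openE.
have [y by_ wy] := dist_attained bne bO w.
apply: contrapT => nsing.
(* The unit vector pointing away from the nearest point y, assumed unique for contradiction; moving
   along v should increase d faster than lam. *)
pose v := (d w)^-1 *: (w - y).
have v1 : enorm v = 1.
  by rewrite enormZ wy ger0_norm ?mulVf ?gt_eqF// invr_ge0 ltW.
(* The boundary points from which a move along v recedes with slope at most lam. This set is compact
   and misses y, so by uniqueness of y it stays at a distance m > d w from w. *)
pose K := boundary Om `&` [set p | dot v (w - p) - lam * enorm (w - p) <= 0].
have uniq p : boundary Om p -> enorm (w - p) = d w -> p = y.
  move=> bp wp; apply: contrapT => py; apply: nsing; split => //.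
  by exists p, y.
have nKy : ~ K y.
  rewrite /K/= => -[_]; rewrite wy dotZl -sqr_enorm wy expr2 mulKf ?gt_eqF//.
  by apply/negP; rewrite -ltNge subr_gt0 gtr_pMl.
have cK : compact K.
  apply: (@subclosed_compact _ K (boundary Om)) (compact_boundary bO) _; last exact: subIsetl.
  apply: closedI; first exact: closed_boundary.
  have cG : continuous (fun p : 'rV[R]_n => dot v (w - p) - lam * enorm (w - p)).
    apply: continuous_subr.
      apply: continuous_sumr => i; under eq_fun do rewrite !mxE.
      apply: continuous_mulr; first exact: cst_continuous.
      apply: continuous_subr; first exact: cst_continuous.
      exact: coord_continuous.
    apply: continuous_mulr; first exact: cst_continuous.
    by under eq_fun do rewrite enorm_distC; exact: (lip1_continuous (lip1_enorm w)).
  by move/continuous_closedP : cG => /(_ [set t | t <= 0]); apply; exact: closed_le.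
have [m dm mK] : exists2 m, d w < m & forall p, K p -> m <= enorm (w - p).
  have [K0|/set0P K0] := eqVneq K set0.
    by exists (d w + 1); [rewrite ltrDl|move=> p; rewrite K0].
  have [p] := compact_EVT_min K0 cK (continuous_subspaceT (lip1_continuous (lip1_enorm w))).
  rewrite inE => Kp hp; exists (enorm (w - p)); last first.
    by move=> q Kq; rewrite !(enorm_distC w); apply: hp; rewrite inE.
  rewrite lt_def dist_le ?andbT//; last by case: Kp.
  apply/eqP => wp; apply: nKy; rewrite -(uniq p)//; by case: Kp.
(* The bound h < d w keeps z in Om; the bound 2 h < m - d w prevents the nearest point of z from
   lying in K. *)
pose h := Num.min (d w / 2) ((m - d w) / 4).
have h0 : 0 < h by rewrite lt_min !divr_gt0// subr_gt0.
have hd : h < d w by rewrite gt_min ltr_pdivrMr// ltr_pMr// ltr1n.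
have hm : 2 * h < m - d w.
  have : h <= (m - d w) / 4 by rewrite ge_min lexx orbT.
  lra.
pose z := w + h *: v.
have zw : enorm (z - w) = h.
  by rewrite /z addrC addrA addNr add0r enormZ v1 mulr1 ger0_norm// ltW.
have Oz : Om z by apply: (dist_ball bne oO Ow); rewrite zw.
have dz : d z <= d w + lam * h.
  have := maxw z Oz; rewrite /F.
  have : lam * enorm (z - x0) <= lam * (h + enorm (w - x0)).
    by rewrite ler_wpM2l// -zw enorm_triangle.
  lra.
have [q bq zq] := dist_attained bne bO z.
have wq0 : 0 < enorm (w - q) by apply: lt_le_trans dw0 _; exact: dist_le.
(* If q were in K, then m <= |w - q| <= h + d z <= d w + 2 h < m. *)
have [Kq|nKq] := pselect (K q).
  have := mK q Kq; have := enorm_triangle z w q.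
  rewrite (enorm_distC w z) zw zq.
  have : lam * h <= h by rewrite ger_pMl// ltW.
  lra.
have {}nKq : lam * enorm (w - q) < dot v (w - q).
  by rewrite -subr_gt0 ltNge; apply/negP => ?; apply: nKq.
(* For q outside K, the inner product exceeds (|w - q| + lam h) |w - q|, whereas Cauchy-Schwarz
   bounds it by d z |w - q| and maximality of w gives d z <= d w + lam h <= |w - q| + lam h. *)
have := cauchy_schwarz (z - q) (w - q).
have -> : dot (z - q) (w - q) = enorm (w - q) ^+ 2 + h * dot v (w - q).
  by rewrite /z addrAC dotDl dotZl sqr_enorm.
have := dist_le bne w bq.
have : h * (lam * enorm (w - q)) < h * dot v (w - q) by rewrite ltr_pM2l.
have : d z * enorm (w - q) <= (d w + lam * h) * enorm (w - q).
  by rewrite ler_pM2r.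
rewrite zq => h1 h2 h3 h4.
have : d w * enorm (w - q) <= enorm (w - q) * enorm (w - q) by rewrite ler_pM2r.
rewrite -expr2; lra.
Qed.

(** Equality would put x0 on the segment from x to each point p nearest to x0: the triangle
    inequality through x0 becomes an equality. Then x0 - p is the multiple of x - x0 of length d x0,
    so p would be unique. *)
Lemma dist_lt_singular x0 x : singular_set Om x0 -> x != x0 ->
  d x < d x0 + enorm (x - x0).
Proof.
move=> [Ox0 [y [z [by_ bz yz xy xz]]]] xx0.
rewrite ltNge; apply/negP => h; apply: yz.
have a0 : enorm (x - x0) != 0 by rewrite gt_eqF// enorm_gt0// subr_eq0.
suff nearest p : boundary Om p -> enorm (x0 - p) = d x0 ->
    enorm (x - x0) *: (x0 - p) = d x0 *: (x - x0).
  have := nearest _ by_ xy; rewrite -(nearest _ bz xz) => /(scalerI a0).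
  by move=> /addrI/oppr_inj.
move=> bp xp.
have e1 : enorm (x - p) = enorm (x - x0) + d x0.
  apply/eqP; rewrite eq_le -{1}xp enorm_triangle/= addrC.
  by apply: le_trans h _; exact: dist_le.
(* Squaring the additivity of the norms gives the equality case of Cauchy-Schwarz, which forces
   proportionality. *)
have e2 : dot (x - x0) (x0 - p) = enorm (x - x0) * d x0.
  move: e1; rewrite -(subrKA x0) -xp; move: (x - x0) (x0 - p) => a b e1.
  have := sqr_enorm (a + b); rewrite e1 sqrrD.
  rewrite dotDl !dotDr (dotC b) -!sqr_enorm; lra.
apply/eqP; rewrite -subr_eq0; apply/eqP; apply: dot_eq0.
move: e2; rewrite -xp; move: (x - x0) (x0 - p) => a b e2.
by rewrite !dotE (dotC b a) e2 -!sqr_enorm; ring.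
Qed.

(** Compactness makes the strict inequality of [dist_lt_singular] uniform away from x0. *)
Lemma singular_gap x0 r : singular_set Om x0 -> 0 < r ->
  exists2 e, 0 < e <= d x0 & forall x, closure Om x -> r <= enorm (x - x0) ->
    d x <= d x0 - e + enorm (x - x0).
Proof.
move=> sx0 r0; have dx0 := dist_gt0 bne oO bO sx0.1.
pose K := closure Om `&` [set x | r <= enorm (x - x0)].
have [K0|/set0P K0] := eqVneq K set0.
  exists (d x0); first by rewrite dx0/=.
  by move=> x cx rx; have : K x by []; rewrite K0.
have cK : compact K.
  apply: (@subclosed_compact _ K (closure Om)) (compact_closure bO) _; last exact: subIsetl.
  apply: closedI; first exact: closed_closure.
  have /continuous_closedP/(_ [set t | r <= t]) := lip1_continuous (lip1_enorm x0).
  by apply; exact: closed_ge.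
have cF : continuous (fun x : 'rV[R]_n => d x0 + enorm (x - x0) - d x).
  apply: continuous_subr; last exact: (lip1_continuous (lip1_dist bne)).
  apply: continuous_addr; first exact: cst_continuous.
  exact: (lip1_continuous (lip1_enorm x0)).
have [p] := compact_EVT_min K0 cK (continuous_subspaceT cF).
rewrite inE => -[clp rp] hp.
(* Capping the gap by d x0 keeps the lowered cone nonnegative, so that truncating by it does not
   change d on the boundary. *)
exists (Num.min (d x0) (d x0 + enorm (p - x0) - d p)).
  rewrite lt_min dx0/= subr_gt0 ge_min lexx/= andbT.
  apply: dist_lt_singular => //; apply/eqP => px0.
  by move: rp; rewrite /= px0 subrr enorm0 leNgt r0.
move=> x cx rx.
have : d x0 + enorm (p - x0) - d p <= d x0 + enorm (x - x0) - d x.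
  by apply: hp; rewrite inE.
have : Num.min (d x0) (d x0 + enorm (p - x0) - d p) <= d x0 + enorm (p - x0) - d p.
  by rewrite ge_min lexx orbT.
lra.
Qed.

End climb.

(** * One-sided difference quotients *)

Section quotients.
Context {R : realType} {n : nat}.
Implicit Types (x w p : 'rV[R]_n) (u v : 'rV[R]_n -> R).

Definition step (k : nat) : R := k.+1%:R^-1.

Lemma step_gt0 k : 0 < step k. Proof. by rewrite invr_gt0. Qed.

Lemma step_le1 k : step k <= 1. Proof. by rewrite invf_le1// ler1n. Qed.

Lemma cvg_step : step k @[k --> \oo] --> 0.
Proof. exact: cvg_harmonic. Qed.

(** One-sided, and taken along the sequence of steps 1/(k+1), so that dominated convergence
    applies. *)
Definition quot u x w (k : nat) : R := k.+1%:R * (u (x + step k *: w) - u x).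

Lemma cvg_step_line x w : (x + step k *: w) @[k --> \oo] --> x.
Proof.
suff : (x + step k *: w) @[k --> \oo] --> x + 0 *: w by rewrite scale0r addr0.
by apply: cvgD; [exact: cvg_cst|apply: cvgZl; exact: cvg_step].
Qed.

Lemma lip1_cvg u x w : lip1 u -> u (x + step k *: w) @[k --> \oo] --> u x.
Proof.
move=> lu; apply: cvg_comp; first exact: cvg_step_line.
exact: lip1_continuous.
Qed.

Lemma quot_le u v x w k : u x = v x -> (forall y, u y <= v y) -> quot u x w k <= quot v x w k.
Proof. by move=> uvx uv; rewrite /quot uvx ler_wpM2l// lerB. Qed.

Lemma norm_quot_le u x w k : lip1 u -> `|quot u x w k| <= enorm w.
Proof.
move=> lu; rewrite normrM ger0_norm// mulrC -ler_pdivlMr//.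
apply: le_trans (lip1_norm _ _ lu) _.
by rewrite addrC addKr enormZ gtr0_norm ?step_gt0// mulrC.
Qed.

Lemma quotD u (c : R) x w : quot (fun y => c + u y) x w = quot u x w.
Proof. by apply/funext => k; rewrite /quot opprD addrACA subrr add0r. Qed.

(** Factoring a difference of squares turns quotients of u^2 into those of u. Both applications, to
    [hyperb] and to d, have a simpler square. *)
Lemma cvg_quot_sqr u x w (l : R) : lip1 u -> (forall y, 0 <= u y) -> 0 < u x ->
  quot (fun y => u y ^+ 2) x w k @[k --> \oo] --> l ->
  quot u x w k @[k --> \oo] --> l / (u x + u x).
Proof.
move=> lu u0 ux h.
have -> : quot u x w = fun k => quot (fun y => u y ^+ 2) x w k / (u (x + step k *: w) + u x).
  apply/funext => k; rewrite /quot subr_sqr -!mulrA mulfV ?mulr1//.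
  by rewrite gt_eqF// ltr_wpDl.
apply: cvgM => //; apply: cvgV; first by rewrite gt_eqF// addr_gt0.
by apply: cvgD; [exact: lip1_cvg|exact: cvg_cst].
Qed.

(** A sheet of a hyperboloid asymptotic to the cone |. - p|: the cone itself for c = 0, a smooth
    function above it for c > 0. *)
Definition hyperb (c : R) p x : R := Num.sqrt (c + dot (x - p) (x - p)).

Lemma hyperb0 p x : hyperb 0 p x = enorm (x - p).
Proof. by rewrite /hyperb add0r enormE. Qed.

Lemma hyperb_ge0 c p x : 0 <= hyperb c p x. Proof. exact: sqrtr_ge0. Qed.

Lemma sqr_hyperb c p x : 0 <= c -> hyperb c p x ^+ 2 = c + dot (x - p) (x - p).
Proof. by move=> c0; rewrite sqr_sqrtr// addr_ge0// dot_ge0. Qed.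

Lemma enorm_le_hyperb c p x : 0 <= c -> enorm (x - p) <= hyperb c p x.
Proof. by move=> c0; rewrite enormE ler_wsqrtr// lerDr. Qed.

(** The difference of the squares at x and y is the inner product of x - y with (x - p) + (y - p),
    hence at most |x - y| times the sum of the two values; divide by that sum. *)
Lemma lip1_hyperb c p : 0 <= c -> lip1 (hyperb c p).
Proof.
move=> c0 x y.
have [->|hx] := eqVneq (hyperb c p x) 0.
  by rewrite sub0r (le_trans _ (enorm_ge0 _))// oppr_le0 hyperb_ge0.
have s0 : 0 < hyperb c p x + hyperb c p y.
  by rewrite ltr_wpDr ?hyperb_ge0// lt_def hx hyperb_ge0.
rewrite -(ler_pM2r s0) -subr_sqr !sqr_hyperb//.
rewrite opprD addrACA subrr add0r.
have -> : x - p = (x - y) + (y - p) by rewrite subrKA.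
have h1 := enorm_le_hyperb p x c0; have h2 := enorm_le_hyperb p y c0.
have h3 := cauchy_schwarz (x - y) (y - p).
have h4 := cauchy_schwarz (x - y) (x - y + (y - p)).
rewrite subrKA in h4.
have e0 := enorm_ge0 (x - y).
have -> : dot (x - y + (y - p)) (x - y + (y - p)) - dot (y - p) (y - p) =
  dot (x - y) (x - y + (y - p)) + dot (x - y) (y - p).
  move: (x - y) (y - p) => a b; rewrite !dotE (dotC b a); ring.
rewrite subrKA mulrDr; apply: lerD.
  by apply: le_trans h4 _; rewrite ler_wpM2l.
by apply: le_trans h3 _; rewrite ler_wpM2l.
Qed.

Lemma cvg_quot_hyperb c p x w : 0 <= c -> 0 < hyperb c p x ->
  quot (hyperb c p) x w k @[k --> \oo] --> dot ((hyperb c p x)^-1 *: (x - p)) w.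
Proof.
move=> c0 hx.
have -> : dot ((hyperb c p x)^-1 *: (x - p)) w =
  (2 * dot (x - p) w) / (hyperb c p x + hyperb c p x).
  by rewrite dotZl; field; rewrite !gt_eqF// addr_gt0.
apply: cvg_quot_sqr => //; [exact: lip1_hyperb|exact: hyperb_ge0|].
have -> : quot (fun y => hyperb c p y ^+ 2) x w =
  fun k => 2 * dot (x - p) w + step k * dot w w.
  apply/funext => k; rewrite /quot !sqr_hyperb// opprD addrACA subrr add0r.
  rewrite addrAC; move: (x - p) => a; rewrite !dotE (dotC w a) /step; field.
  by rewrite nat1r pnatr_eq0.
rewrite -[X in _ --> X]addr0 -[X in _ --> _ + X](mul0r (dot w w)).
apply: cvgD; first exact: cvg_cst.
by apply: cvgM; [exact: cvg_step|exact: cvg_cst].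
Qed.

Lemma cvg_minr (a b : nat -> R) (la lb : R) :
  a k @[k --> \oo] --> la -> b k @[k --> \oo] --> lb ->
  Num.min (a k) (b k) @[k --> \oo] --> Num.min la lb.
Proof.
move=> ha hb.
have minE (s t : R) : Num.min s t = 2^-1 * (s + t - `|s - t|).
  by case: (lerP s t) => st; field.
rewrite minE (_ : (fun k => _) = fun k => 2^-1 * (a k + b k - `|a k - b k|)).
  apply: cvgMr; apply: cvgB; first exact: cvgD.
  by apply: cvg_norm; exact: cvgB.
by apply/funext => k; rewrite minE.
Qed.

(* At [x], [u] has one-sided derivatives in all directions, lying below a linear
   form of norm at most 1; where they are odd in the direction they coincide
   with that form. *)
Definition tame u x :=
  (forall w, cvgn (quot u x w)) /\
  exists2 q, enorm q <= 1 & forall w, limn (quot u x w) <= dot q w.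

Lemma tameD u (c : R) x : tame u x -> tame (fun y => c + u y) x.
Proof.
move=> [cu [q q1 hq]]; split=> [w|]; first by rewrite quotD; exact: cu.
by exists q => // w; rewrite quotD.
Qed.

Lemma tame_hyperb c p x : 0 <= c -> 0 < hyperb c p x -> tame (hyperb c p) x.
Proof.
move=> c0 hx; split=> [w|].
  by apply/cvg_ex; eexists; exact: cvg_quot_hyperb.
exists ((hyperb c p x)^-1 *: (x - p)).
  rewrite enormZ ger0_norm ?invr_ge0 ?hyperb_ge0// mulrC ler_pdivrMr// mul1r.
  exact: enorm_le_hyperb.
by move=> w; have /cvg_lim -> := cvg_quot_hyperb (w := w) c0 hx.
Qed.

(** Where the values differ, the minimum eventually has the quotients of the smaller function. Where
    they agree, its quotients are the minima of the two, and either linear form dominates. *)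
Lemma tame_min u v x : lip1 u -> lip1 v -> tame u x -> tame v x ->
  tame (fun y => Num.min (u y) (v y)) x.
Proof.
move=> lu lv [cu [qu qu1 hu]] [cv [qv qv1 hv]].
pose m y := Num.min (u y) (v y).
have mC : (fun y => Num.min (u y) (v y)) = (fun y => Num.min (v y) (u y)).
  by apply/funext => y; rewrite minC.
have strict (a b : 'rV[R]_n -> R) w : lip1 a -> lip1 b -> a x < b x -> cvgn (quot a x w) ->
    quot (fun y => Num.min (a y) (b y)) x w k @[k --> \oo] --> limn (quot a x w).
  move=> la lb ab ca.
  apply: cvg_trans ca; apply: near_eq_cvg.
  have : \forall k \near \oo, a (x + step k *: w) < b (x + step k *: w).
    have hb : b (x + step k *: w) @[k --> \oo] --> b x by exact: lip1_cvg.
    have ha : a (x + step k *: w) @[k --> \oo] --> a x by exact: lip1_cvg.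
    have h := cvgB (FF := eventually_filter) hb ha.
    have : 0 < b x - a x by rewrite subr_gt0.
    move=> /(cvgr_gt _ h); apply: filterS => k /=.
    by rewrite subr_gt0.
  by apply: filterS => k /ltW kab; rewrite /quot !min_l// ltW.
have [uv|vu|uv] := ltgtP (u x) (v x).
- split=> [w|].
    by apply/cvg_ex; eexists; exact: strict.
  by exists qu => // w; have /cvg_lim -> // := strict _ _ w lu lv uv (cu w).
- rewrite mC; split=> [w|].
    by apply/cvg_ex; eexists; exact: strict.
  by exists qv => // w; have /cvg_lim -> // := strict _ _ w lv lu vu (cv w).
have E w : quot (fun y => Num.min (u y) (v y)) x w =
    fun k => Num.min (quot u x w k) (quot v x w k).
  apply/funext => k; rewrite /quot -uv minxx -minr_pMr//.
  by rewrite addr_minl.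
have C w : quot (fun y => Num.min (u y) (v y)) x w k @[k --> \oo] -->
    Num.min (limn (quot u x w)) (limn (quot v x w)).
  by rewrite E; apply: cvg_minr; [exact: cu|exact: cv].
split=> [w|]; first by apply/cvg_ex; eexists; exact: C.
exists qu => // w; have /cvg_lim -> // := C w.
by apply: le_trans (hu w); rewrite ge_min lexx.
Qed.

(** Convergence comes from the semiconcavity of d^2. The dominating form is the derivative at x of
    the cone |. - p| over a nearest point p, which lies above d and touches it at x. *)
Lemma tame_dist (Om : set 'rV[R]_n) x :
  boundary Om !=set0 -> open Om -> bounded_set Om -> Om x ->
  tame (dist_boundary Om) x.
Proof.
move=> bne oO bO Ox; set d := dist_boundary Om.
have dx0 : 0 < d x := dist_gt0 bne oO bO Ox.
have ld : lip1 d := lip1_dist bne.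
have cd w : cvgn (quot d x w).
  suff [l hl] : exists l : R, quot (fun y => d y ^+ 2) x w k @[k --> \oo] --> l.
    apply/cvg_ex; eexists; apply: cvg_quot_sqr hl => //.
    by move=> y; exact: dist_ge0.
  pose A (s : R) := d (x + s *: w) ^+ 2 - s ^+ 2 * dot w w.
  (* Slopes of a concave function from 0: they increase as the step shrinks, and the Lipschitz bound
     on d keeps them bounded. *)
  pose a k := k.+1%:R * (A (step k) - A 0).
  have A0 : A 0 = d x ^+ 2 by rewrite /A scale0r addr0 expr0n mul0r subr0.
  have aE k : quot (fun y => d y ^+ 2) x w k = a k + step k * dot w w.
    by rewrite /a A0 /A /quot /step; field; rewrite nat1r pnatr_eq0.
  (* [A] is an infimum of affine functions, hence concave. *)
  have Aconc s t : 0 < s -> s <= t -> s * (A t - A 0) <= t * (A s - A 0).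
    move=> s0 st; have [q bq xq] := dist_attained bne bO (x + s *: w).
    have sqr r : enorm (x + r *: w - q) ^+ 2 - r ^+ 2 * dot w w =
        dot (x - q) (x - q) + r * (2 * dot (x - q) w).
      rewrite sqr_enorm addrAC; move: (x - q) => b; rewrite !dotE (dotC w b); ring.
    have At r : A r <= dot (x - q) (x - q) + r * (2 * dot (x - q) w).
      rewrite /A -sqr lerB// lerXn2r ?nnegrE ?enorm_ge0 ?dist_ge0//.
      exact: dist_le.
    have As : A s = dot (x - q) (x - q) + s * (2 * dot (x - q) w).
      by rewrite -sqr /A xq.
    have := At 0; have := At t; rewrite As mul0r addr0.
    move: (dot (x - q) (x - q)) (2 * dot (x - q) w) (A 0) (A t) => D E A0' At' h1 h2.
    have : s * (At' - A0') <= s * (D + t * E - A0') by rewrite ler_pM2l// lerB.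
    have : 0 <= (t - s) * (D - A0') by rewrite mulr_ge0 ?subr_ge0.
    move=> h3 h4; apply: le_trans h4 _.
    rewrite -subr_ge0; apply: le_trans h3 _; rewrite le_eqVlt; apply/orP; left.
    by apply/eqP; ring.
  have a_nd : nondecreasing_seq a.
    apply/nondecreasing_seqP => k; rewrite /a.
    have := @Aconc (step k.+1) (step k) (step_gt0 _).
    rewrite lef_pV2 ?posrE// ler_nat => /(_ (leqnSn _)).
    rewrite /step ![_^-1 * _]mulrC ler_pdivrMr// mulrAC ler_pdivlMr//.
    by rewrite mulrC [X in _ -> _ <= X]mulrC.
  have a_ub : has_ubound (range a).
    exists (enorm w * (2 * d x + enorm w) + dot w w) => _ [k _ <-].
    have -> : a k = quot (fun y => d y ^+ 2) x w k - step k * dot w w.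
      by rewrite aE addrK.
    have := norm_quot_le x w k ld; rewrite /quot.
    set D := d (x + _) => hD.
    have D0 : 0 <= D by exact: dist_ge0.
    have h1 : k.+1%:R * (D - d x) <= enorm w by apply: le_trans (ler_norm _) hD.
    have Dx : D <= d x + enorm w.
      have := ld (x + step k *: w) x; rewrite -/D [x + _]addrC addrK enormZ.
      rewrite gtr0_norm ?step_gt0// => h.
      rewrite -lerBlDl; apply: le_trans h _.
      by rewrite ler_piMl ?enorm_ge0// step_le1.
    rewrite subr_sqr mulrA.
    have h2 : k.+1%:R * (D - d x) * (D + d x) <= enorm w * (2 * d x + enorm w).
      apply: (@le_trans _ _ (enorm w * (D + d x))).
        by rewrite ler_wpM2r// addr_ge0// ltW.
      rewrite ler_wpM2l ?enorm_ge0//; lra.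
    have := dot_ge0 w => w0.
    have : 0 <= step k * dot w w by rewrite mulr_ge0// ltW// step_gt0.
    lra.
  have /cvg_ex[l al] := nondecreasing_is_cvgn a_nd a_ub.
  exists (l + 0 * dot w w); rewrite (_ : quot _ x w = fun k => a k + step k * dot w w).
    by apply: cvgD => //; apply: cvgM; [exact: cvg_step|exact: cvg_cst].
  by apply/funext.
split => //.
have [p bp xp] := dist_attained bne bO x.
have hx : 0 < hyperb 0 p x by rewrite hyperb0 xp.
exists ((hyperb 0 p x)^-1 *: (x - p)).
  by rewrite enormZ hyperb0 xp ger0_norm ?mulVf ?gt_eqF// invr_ge0 ltW.
move=> w; have /cvg_lim <- // := cvg_quot_hyperb (w := w) (lexx 0) hx.
apply: ler_lim => //; first by apply/cvg_ex; eexists; exact: cvg_quot_hyperb.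
apply: nearW => k; apply: quot_le; first by rewrite hyperb0.
by move=> y; rewrite hyperb0; exact: dist_le.
Qed.

End quotients.

(** * Smooth bumps *)

Section bump1.
Context {R : realType}.
Implicit Types (p : {poly R}) (m : nat) (x : R).

Local Notation q := (1 - 'X ^+ 2 : {poly R}).

(* The derivatives of [exp (- 1 / (1 - x ^ 2))] all have this shape. *)
Definition bump p m x : R :=
  if `|x| < 1 then p.[x] * (q.[x] ^+ m)^-1 * expR (- (q.[x])^-1) else 0.

(** The numerator over q^(m+2) given by the product rule, with q' = -2 x. *)
Definition bump_next p m : {poly R} :=
  p^`() * q ^+ 2 + (2 * m)%:R *: ('X * p * q) - 2 *: ('X * p).

Lemma horner_qE x : q.[x] = (1 - x) * (1 + x).
Proof. by rewrite !hornerE/=; ring. Qed.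

Lemma horner_q_gt0 x : `|x| < 1 -> 0 < q.[x].
Proof.
rewrite ltr_norml => /andP[x1 x2]; rewrite horner_qE mulr_gt0//.
  by rewrite subr_gt0.
by rewrite -[1]opprK addrC subr_gt0.
Qed.

(* [exp (- 1/t) <= (k t) ^ k] makes all the derivatives vanish at the end points. *)
Lemma expR_inv_le (t : R) (k : nat) : 0 < t -> expR (- t^-1) <= (k.+1%:R * t) ^+ k.+1.
Proof.
move=> t0; set a := (k.+1%:R * t)^-1.
have a0 : 0 < a by rewrite invr_gt0 mulr_gt0.
have -> : - t^-1 = k.+1%:R * - a by rewrite /a; field; rewrite nat1r pnatr_eq0 gt_eqF.
rewrite expRM_natl; apply: lerXn2r; rewrite ?nnegrE ?expR_ge0 ?mulr_ge0 ?(ltW t0)//.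
rewrite expRN -[leRHS]invrK lef_pV2 ?posrE ?expR_gt0//.
apply: le_trans (expR_ge1Dx _); rewrite -/a; lra.
Qed.

Lemma horner_bound p : exists2 C, 0 <= C & forall x, `|x| <= 1 -> `|p.[x]| <= C.
Proof.
exists (\sum_(i < size p) `|p`_i|); first by apply: sumr_ge0.
move=> x x1; rewrite horner_coef; apply: (le_trans (ler_norm_sum _ _ _)).
apply: ler_sum => i _; rewrite normrM normrX ler_piMr// exprn_ile1//.
Qed.

(** The exponential is bounded by a multiple of q^(m+2): m factors absorb the denominator, and the
    two left over give the quadratic vanishing needed to differentiate at the end points. *)
Lemma bump_sqr_le p m : exists2 C, 0 <= C &
  forall x, `|bump p m x| <= (if `|x| < 1 then C * q.[x] ^+ 2 else 0).
Proof.
have [C C0 hC] := horner_bound p.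
exists (C * (m.+2%:R) ^+ m.+2); first by rewrite mulr_ge0// exprn_ge0.
move=> x; rewrite /bump; case: ifPn => [x1|_]; last by rewrite normr0.
have t0 := horner_q_gt0 x1; set t := q.[x] in t0 *.
have h : expR (- t^-1) <= t ^+ m * (m.+2%:R ^+ m.+2 * t ^+ 2).
  apply: le_trans (expR_inv_le m.+1 t0) _.
  by rewrite mulrCA -exprD addn2 exprMn.
move: (m.+2%:R ^+ m.+2) h => K h.
rewrite !normrM (ger0_norm (expR_ge0 _)) -!mulrA; apply: ler_pM => //.
  by rewrite hC// ltW.
by rewrite normfV (@ger0_norm _ (t ^+ m)) ?exprn_ge0 ?(ltW t0)// ler_pdivrMl ?exprn_gt0.
Qed.

Lemma bump_bounded p m : exists2 C, 0 <= C & forall x, `|bump p m x| <= C.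
Proof.
have [C C0 hC] := bump_sqr_le p m; exists C => // x; apply: le_trans (hC x) _.
case: ifPn => // x1; have t0 := horner_q_gt0 x1.
rewrite ler_piMr// exprn_ile1 ?(ltW t0)//.
by rewrite !hornerE/= gerBl sqr_ge0.
Qed.

Lemma is_derive_bump p m x : is_derive x 1 (bump p m) (bump (bump_next p m) m.+2 x).
Proof.
have [x1|x1] := ltP `|x| 1.
  pose f := horner p * (fun y => ((horner q ^+ m) y)^-1) * (expR \o (- (fun y => (horner q y)^-1))).
  have fE y : f y = p.[y] * (q.[y] ^+ m)^-1 * expR (- (q.[y])^-1).
    by rewrite /f /= exprfctE.
  apply: (@near_eq_is_derive _ _ _ f).
    have : \forall y \near x, `|y| < 1.
      have : continuous (fun y : R => `|y|) by exact: norm_continuous.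
      by move=> /(_ x)/(cvgr_lt _); apply.
    by apply: filterS => y y1; rewrite fE /bump y1.
  have q0 : horner q x != 0 by rewrite gt_eqF// horner_q_gt0.
  have qm0 : (horner q ^+ m) x != 0 by rewrite exprfctE expf_neq0.
  have h1 := is_deriveV qm0 (is_deriveX m (is_derive_poly q x)).
  have h2 := is_deriveV q0 (is_derive_poly q x).
  have h3 := is_derive1_comp (is_derive_expR _) (is_deriveN h2).
  apply: (is_derive_eq (is_deriveM (is_deriveM (is_derive_poly p x) h1) h3)).
  have dq : q^`().[x] = - (2 * x).
    by rewrite derivB derivC derivXn !hornerE/=; ring.
  pose Q := q.[x]; pose e := expR (- Q^-1); pose P := p.[x]; pose P' := p^`().[x].
  transitivity (P / Q ^+ m * (e * - (- Q ^- 2 * q^`().[x])) +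
    e * (P * (- (Q ^+ m) ^- 2 * (m%:R * Q ^+ m.-1 * q^`().[x])) + (Q ^+ m)^-1 * P')).
    by rewrite /= !exprfctE.
  have -> : bump (bump_next p m) m.+2 x =
      (P' * Q ^+ 2 + (2 * m)%:R * (x * P * Q) - 2 * (x * P)) / Q ^+ m.+2 * e.
    rewrite /bump x1 /bump_next; congr (_ / _ * _).
    by rewrite hornerD hornerN hornerD !hornerZ !hornerM hornerX.
  rewrite dq {h1 h2 h3 qm0 fE f dq}; move: q0; rewrite -/Q.
  move: Q @e P P' => Q e P P' q0; move: e => e.
  (* Differentiating q^m produces the exponent [m.-1], which needs m = 0 apart. *)
  case: m => [|m] /=; first by field.
  by rewrite !exprS natrM; field; rewrite q0 expf_neq0.
have fx0 : bump p m x = 0 by rewrite /bump ltNge x1.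
rewrite [X in is_derive _ _ _ X](_ : _ = 0); last by rewrite /bump ltNge x1.
have [C C0 hC] := bump_sqr_le p m.
(* Here |x| >= 1. For |z| < 1 one factor of q(z) = (1 - z)(1 + z) is at most |z - x| and the other
   at most 2, so the function is quadratically small at x and its derivative there is 0. *)
have hC2 z : `|bump p m z| <= 4 * C * `|z - x| ^+ 2.
  apply: le_trans (hC z) _; case: ifPn => z1; last by rewrite !mulr_ge0// exprn_ge0.
  rewrite (mulrC 4) -mulrA; apply: ler_wpM2l => //.
  have -> : 4 * `|z - x| ^+ 2 = (2 * `|z - x|) ^+ 2 by ring.
  apply: lerXn2r; rewrite ?nnegrE ?mulr_ge0 ?(ltW (horner_q_gt0 z1))//.
  move: z1; rewrite horner_qE ltr_norml => /andP[z1 z2].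
  have [x0|x0] := leP 0 x.
    rewrite ger0_norm// in x1.
    rewrite distrC ger0_norm; last lra.
    rewrite [leRHS]mulrC; apply: ler_pM; lra.
  rewrite ltr0_norm// in x1.
  rewrite ger0_norm; last lra.
  apply: ler_pM; lra.
apply/is_derive1_caratheodory; exists (fun z => bump p m z / (z - x)); split.
- move=> z; rewrite fx0 subr0; have [->|zx] := eqVneq z x.
    by rewrite subrr mulr0.
  by rewrite divfK// subr_eq0.
- have hx : bump p m x / (x - x) = 0 by rewrite subrr invr0 mulr0.
  apply/(@cvgrPdist_lt _ _ _ _ (nbhs_filter x)) => e e0; rewrite hx.
  have C1 : 0 < 4 * C + 1 by rewrite ltr_wpDl// mulr_ge0.
  near=> z; rewrite sub0r normrN.
  have [->|zx] := eqVneq z x; first by rewrite hx normr0.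
  have zx0 : 0 < `|z - x| by rewrite normr_gt0 subr_eq0.
  apply: (@le_lt_trans _ _ (4 * C * `|z - x|)).
    by rewrite normrM normfV ler_pdivrMr// -[leRHS]mulrA -expr2.
  apply: (@le_lt_trans _ _ ((4 * C + 1) * `|z - x|)); first by rewrite ler_wpM2r// lerDl.
  rewrite mulrC -ltr_pdivlMr//.
  by near: z; apply: cvgr_distC_lt; [exact: cvg_id|rewrite divr_gt0].
- by rewrite subrr invr0 mulr0.
Unshelve. all: by end_near. Qed.

(** The k-th derivative of the bump exp(-1/(1 - x^2)); the iterated pair records the polynomial and
    the exponent of the denominator. *)
Definition bumps (k : nat) : R -> R :=
  let a := iter k (fun a : {poly R} * nat => (bump_next a.1 a.2, a.2.+2)) (1, 0%N) in
  bump a.1 a.2.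

Lemma is_derive_bumps k x : is_derive x 1 (bumps k) (bumps k.+1 x).
Proof. by rewrite /bumps iterS/=; exact: is_derive_bump. Qed.

Lemma bumps_bounded k : exists2 C, 0 <= C & forall x, `|bumps k x| <= C.
Proof. exact: bump_bounded. Qed.

Lemma bumps_eq0 k x : 1 <= `|x| -> bumps k x = 0.
Proof. by move=> x1; rewrite /bumps /bump ltNge x1. Qed.

Lemma bumps0_ge0 x : 0 <= bumps 0 x.
Proof.
rewrite /bumps/= /bump; case: ifPn => // _.
by rewrite expr0 invr1 mulr1 hornerE mul1r expR_ge0.
Qed.

Lemma bumps0_gt0 x : `|x| < 1 -> 0 < bumps 0 x.
Proof.
move=> x1; rewrite /bumps/= /bump x1.
by rewrite expr0 invr1 mulr1 hornerE mul1r expR_gt0.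
Qed.

End bump1.

(** * Mollifiers on cubes, as products of one-dimensional bumps *)

Section mollifier.
Context {R : realType} {n : nat}.
Implicit Types (x c v : 'rV[R]_n) (k : 'I_n -> nat) (e : R).

Definition mol1 e (k : nat) (t : R) : R := (e^-1) ^+ k * bumps k (e^-1 * t).

Lemma is_derive_mol1 e (k : nat) (t : R) : is_derive t 1 (mol1 e k) (mol1 e k.+1 t).
Proof.
have h : is_derive t 1 (fun s => e^-1 * s) (e^-1 *: 1).
  by apply: is_deriveZ; exact: is_derive_id.
have h2 := is_deriveZ ((e^-1) ^+ k) (is_derive1_comp (is_derive_bumps k (e^-1 * t)) h).
apply: (is_derive_eq h2).
by rewrite /mol1 exprSr -mulrA /GRing.scale/= mulr1 [_ * e^-1]mulrC.
Qed.

Lemma continuous_mol1 e (k : nat) : continuous (mol1 e k).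
Proof.
move=> x; apply/differentiable_continuous/derivable1_diffP.
by have [] := is_derive_mol1 e k x.
Qed.

Lemma mol1_bounded e (k : nat) : exists2 C, 0 <= C & forall t : R, `|mol1 e k t| <= C.
Proof.
have [C C0 hC] := @bumps_bounded R k.
exists (`|e^-1 ^+ k| * C); first by rewrite mulr_ge0.
by move=> t; rewrite normrM ler_wpM2l.
Qed.

Lemma mol1_eq0 e (k : nat) (t : R) : 0 < e -> e <= `|t| -> mol1 e k t = 0.
Proof.
move=> e0 et; rewrite /mol1 bumps_eq0 ?mulr0//.
by rewrite normrM ger0_norm ?invr_ge0 ?(ltW e0)// ler_pdivlMl// mulr1.
Qed.

(* [k] counts the derivatives taken in each coordinate, up to sign the same
   whether one differentiates in the variable [x] or in the center [c]. *)
Definition mol e c k x : R := \prod_(i < n) mol1 e (k i) (x ord0 i - c ord0 i).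

Lemma mol_shift e c k x : mol e c k x = mol e 0 k (x - c).
Proof. by apply: eq_bigr => i _; rewrite !mxE oppr0 addr0. Qed.

Lemma continuous_mol e c k : continuous (mol e c k).
Proof.
apply: continuous_prodr => i.
have cg : continuous (fun x : 'rV[R]_n => x ord0 i - c ord0 i).
  exact: (continuous_subr (@coord_continuous _ _ _ _ _) (@cst_continuous _ _ _)).
move=> x; exact: (continuous_comp (cg x) (@continuous_mol1 e (k i) _)).
Qed.

Lemma mol_bounded e k : exists2 C, 0 <= C & forall c x, `|mol e c k x| <= C.
Proof.
have /choice[C hC] : forall i, exists C, 0 <= C /\ forall t, `|mol1 e (k i) t| <= C.
  by move=> i; have [C C0 h] := mol1_bounded e (k i); exists C.
exists (\prod_(i < n) C i); first by apply: prodr_ge0 => i _; have [] := hC i.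
move=> c x; rewrite normr_prod; apply: ler_prod => i _.
by rewrite normr_ge0/=; have [_] := hC i.
Qed.

Lemma mol_support e c k x : 0 < e -> mol e c k x != 0 ->
  forall i, `|x ord0 i - c ord0 i| <= e.
Proof.
move=> e0 + i; apply: contraR; rewrite -ltNge => h.
by apply/eqP; rewrite /mol (bigD1 i)//= mol1_eq0 ?mul0r// ltW.
Qed.

Lemma mol_ge0 e c x : 0 <= mol e c (fun=> 0%N) x.
Proof. by apply: prodr_ge0 => i _; rewrite mulr_ge0// bumps0_ge0. Qed.

Lemma mol_gt0 e c x : 0 < e -> (forall i, `|x ord0 i - c ord0 i| < e) ->
  0 < mol e c (fun=> 0%N) x.
Proof.
move=> e0 h; apply: prodr_gt0 => i _; rewrite /mol1 expr0 mul1r bumps0_gt0//.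
by rewrite normrM ger0_norm ?invr_ge0 ?(ltW e0)// ltr_pdivrMl// mulr1.
Qed.

Lemma is_derive_mol e c k x i :
  is_derive x (delta_mx ord0 i) (mol e c k) (mol e c (fun j => (i == j) + k j)%N x).
Proof.
pose C := \prod_(j < n | j != i) mol1 e (k j) (x ord0 j - c ord0 j).
have E h : mol e c k (h *: delta_mx ord0 i + x) = mol1 e (k i) (h + (x ord0 i - c ord0 i)) * C.
  rewrite /mol (bigD1 i)//= !mxE !eqxx mulr1 addrA; congr (_ * _).
  apply: eq_bigr => j ji; rewrite !mxE (negbTE ji) andbF mulr0 add0r//.
have E0 : mol e c k x = mol1 e (k i) (x ord0 i - c ord0 i) * C.
  by rewrite -[x in LHS]add0r -(scale0r (delta_mx ord0 i)) E add0r.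
set t := x ord0 i - c ord0 i.
have [d1 d2] := is_derive_mol1 e (k i) t.
have : (fun h => h^-1 *: ((mol e c k \o shift x) (h *: delta_mx ord0 i) - mol e c k x))
     @ 0^' --> mol1 e (k i).+1 t * C.
  have -> : (fun h => h^-1 *: ((mol e c k \o shift x) (h *: delta_mx ord0 i) - mol e c k x)) =
     (fun h => (h^-1 *: ((mol1 e (k i) \o shift t) (h *: 1) - mol1 e (k i) t)) * C).
    apply/funext => h; rewrite /= E E0 -/t -mulrBl /GRing.scale/= mulr1 mulrA//.
  by rewrite -d2; apply: cvgM; [exact: d1|exact: cvg_cst].
have -> : mol1 e (k i).+1 t * C = mol e c (fun j => (i == j) + k j)%N x.
  rewrite /mol [RHS](bigD1 i)//= eqxx; congr (_ * _).
  by apply: eq_bigr => j ji; rewrite eq_sym (negbTE ji).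
move=> hl; apply: DeriveDef; last exact: cvg_lim hl.
by apply/cvg_ex; eexists; exact: hl.
Qed.

Lemma partial_mol e c k i :
  partial i (mol e c k) = mol e c (fun j => (i == j) + k j)%N.
Proof. by apply/funext => x; have [_] := is_derive_mol e c k x i. Qed.

Lemma foldr_partial_mol e c s :
  foldr partial (mol e c (fun=> 0%N)) s = mol e c (fun j => count_mem j s).
Proof. by elim: s => //= i s ->; rewrite partial_mol. Qed.

Lemma smooth_mol e c : smooth (mol e c (fun=> 0%N)).
Proof.
move=> s; rewrite foldr_partial_mol; split; first exact: continuous_mol.
by move=> x i; have [] := is_derive_mol e c (fun j => count_mem j s) x i.
Qed.

Lemma test_function_mol (Om : set 'rV[R]_n) e c : 0 < e ->
  (forall x, (forall i, `|x ord0 i - c ord0 i| <= e) -> Om x) ->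
  test_function Om (mol e c (fun=> 0%N)).
Proof.
move=> e0 h.
pose K : set 'rV[R]_n :=
  [set x | forall i, `[c ord0 i - e, c ord0 i + e]%classic (x ord0 i)].
have cK : compact K.
  apply: (@rV_compact _ _ (fun i => `[c ord0 i - e, c ord0 i + e]%classic)).
  by move=> i; exact: segment_compact.
have sK : closure [set x | mol e c (fun=> 0%N) x != 0] `<=` K.
  move/compact_closed : cK => /(_ (@norm_hausdorff _ _)) clK.
  rewrite (closure_id K).1//; apply: closure_subset => x /= hx i.
  by rewrite /= in_itv/= -ler_distl; exact: mol_support hx i.
split; first exact: smooth_mol.
- exact: subclosed_compact (@closed_closure _ _) cK sK.
- move=> x /sK Kx; apply: h => i.
  by have := Kx i; rewrite /= in_itv/= -ler_distl.
Qed.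

Lemma is_derive_prod (I : eqType) (s : seq I) (f df : I -> R -> R) (t : R) :
  uniq s -> (forall i, is_derive t 1 (f i) (df i t)) ->
  is_derive t 1 (fun y => \prod_(i <- s) f i y)
    (\sum_(i <- s) df i t * \prod_(j <- s | j != i) f j t).
Proof.
move=> + hf; elim: s => [_|i s IH /= /andP[si us]].
  rewrite big_nil; under eq_fun do rewrite big_nil.
  exact: is_derive_cst.
have {IH}h := is_deriveM (hf i) (IH us).
have -> : (fun y => \prod_(j <- i :: s) f j y) = f i * (fun y => \prod_(j <- s) f j y).
  by apply/funext => y; rewrite big_cons.
apply: (is_derive_eq h); rewrite big_cons /GRing.scale/= addrC; congr (_ + _).
  rewrite mulrC; congr (_ * _); rewrite big_cons eqxx/= [RHS]big_seq_cond.
  rewrite [LHS]big_seq; apply: eq_bigl => j.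
  by case: (boolP (j \in s)) => //= js; apply/esym/eqP => ji; rewrite ji (negbTE si) in js.
rewrite mulr_sumr !big_seq; apply: eq_bigr => j js.
have ij : i != j by apply/eqP => ij; rewrite -ij (negbTE si) in js.
by rewrite big_cons ij mulrCA.
Qed.

(** Moving the centre along v is minus differentiating in x along v. This turns the derivative of a
    mollification in its centre into an expression tested by the weak gradient. *)
Lemma is_derive_mol_center e c v x (t : R) :
  is_derive t 1 (fun s => mol e (c + s *: v) (fun=> 0%N) x)
    (- \sum_(i < n) v ord0 i * mol e (c + t *: v) (fun j => (i == j)%N) x).
Proof.
pose f i s := mol1 e 0 (x ord0 i - (c ord0 i + s * v ord0 i)).
pose df i s := - v ord0 i * mol1 e 1 (x ord0 i - (c ord0 i + s * v ord0 i)).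
have hf i : is_derive t 1 (f i) (df i t).
  have h1 : is_derive t 1 (fun s => x ord0 i - (c ord0 i + s * v ord0 i)) (- v ord0 i).
    have -> : (fun s => x ord0 i - (c ord0 i + s * v ord0 i)) =
        cst (x ord0 i - c ord0 i) - (v ord0 i *: id).
      by apply/funext => s; rewrite /= opprD addrA mulrC.
    have := is_deriveB (is_derive_cst (x ord0 i - c ord0 i) t 1) (is_deriveZ (v ord0 i) (is_derive_id t 1)).
    by move/is_derive_eq; apply; rewrite sub0r /GRing.scale/= mulr1.
  have := @is_derive1_comp _ (mol1 e 0) _ t _ _ (is_derive_mol1 e 0 _) h1.
  by move/is_derive_eq; apply; rewrite mulrC.
have -> : (fun s => mol e (c + s *: v) (fun=> 0%N) x) =
    (fun y => \prod_(i <- index_enum 'I_n) f i y).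
  by apply/funext => s; apply: eq_bigr => i _; rewrite !mxE.
apply: (is_derive_eq (is_derive_prod (index_enum_uniq _) hf)).
rewrite -sumrN; apply: eq_bigr => i _; rewrite /df mulNr mulNr -mulrA; congr (- (_ * _)).
rewrite /mol [RHS](bigD1 i)//= eqxx !mxE; congr (_ * _).
by apply: eq_bigr => j ji; rewrite !mxE /f eq_sym (negbTE ji).
Qed.

End mollifier.

(** * Integrals of boundedly supported functions *)

Section bounded_support.
Context {R : realType} {n : nat}.
Local Notation mu := (@lebesgue_rV R n).
Implicit Types (f g : 'rV[R]_n -> R) (D Om : set 'rV[R]_n).

Lemma bounded_le (T : Type) (V : normedModType R) (h : T -> V) (A : set T) (M : R) :
  (forall x, A x -> `|h x| <= M) -> [bounded h x | x in A].
Proof.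
move=> hM; exists M; split; first exact: num_real.
by move=> N MN x Ax; exact: le_trans (hM x Ax) (ltW MN).
Qed.

Lemma lebesgue_rV_bounded D : measurable D -> bounded_set D -> (mu D < +oo)%E.
Proof.
move=> mD /bounded_enorm[M M0 DM].
pose C := [set v : 'rV[R]_n | forall i, `|v ord0 i - (0 : 'rV[R]_n) ord0 i| <= M].
have mC : measurable C by exact: measurable_cube.
apply: (@le_lt_trans _ _ (mu C)).
  apply: le_measure; rewrite ?inE// => x Dx i.
  by rewrite mxE subr0; apply: le_trans (coord_le_enorm x i) (DM x Dx).
by rewrite /C lebesgue_rV_cube ?ltW// ltry.
Qed.

Lemma integrable_bounded D f : measurable D -> bounded_set D ->
  measurable_fun D f -> (exists M, forall x, D x -> `|f x| <= M) ->
  mu.-integrable D (EFin \o f).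
Proof.
move=> mD bD mf [M fM]; apply: measurable_bounded_integrable => //.
  exact: lebesgue_rV_bounded.
exact: bounded_le fM.
Qed.

Lemma measurable_continuous f : continuous f -> measurable_fun setT f.
Proof.
move=> cf; apply: continuous_measurable_rV; first exact: openT.
by move=> x _; exact: cf.
Qed.

(** A class of functions integrable on the whole space and stable under shifts. It contains test
    functions, their partial derivatives and the distance extended by 0, so difference quotients can
    be integrated without regard to Om. *)
Definition bsupp f := [/\ measurable_fun setT f,
  exists M, forall x, `|f x| <= M & exists r, forall x, r < enorm x -> f x = 0].

Definition lbdd g := measurable_fun setT g /\
  forall r, exists M, forall x, enorm x <= r -> `|g x| <= M.

Lemma closed_enorm_ball r : closed [set x : 'rV[R]_n | enorm x <= r].
Proof.
have : continuous (fun x : 'rV[R]_n => enorm x).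
  have := lip1_continuous (lip1_enorm (0 : 'rV[R]_n)).
  by under eq_fun do rewrite subr0.
by move=> /continuous_closedP/(_ [set t | t <= r]); apply; exact: closed_le.
Qed.

Lemma bounded_enorm_ball r : bounded_set [set x : 'rV[R]_n | enorm x <= r].
Proof.
by apply: (@bounded_le _ _ _ _ r) => x xr; exact: le_trans (normr_le_enorm x) xr.
Qed.

Lemma lbdd_continuous g : continuous g -> lbdd g.
Proof.
move=> cg; split; first exact: measurable_continuous.
move=> r.
have cK : compact [set x : 'rV[R]_n | enorm x <= r].
  by apply: bounded_closed_compact; [exact: bounded_enorm_ball|exact: closed_enorm_ball].
have := compact_bounded (continuous_compact (continuous_subspaceT cg) cK).
move=> /ex_strict_bound_gt0[M _ hM]; exists M => x xr.
by apply/ltW/(hM (g x)); exists x.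
Qed.

Lemma bsuppM g f : lbdd g -> bsupp f -> bsupp (fun x => g x * f x).
Proof.
move=> [mg bg] [mf [M fM] [r fr]]; split.
- exact: measurable_funM.
- have [N hN] := bg r; exists (`|N| * M) => x.
  have [xr|xr] := leP (enorm x) r.
    by rewrite normrM ler_pM// (le_trans (hN _ xr))// ler_norm.
  by rewrite fr// mulr0 normr0 mulr_ge0// (le_trans _ (fM 0)).
- by exists r => x xr; rewrite fr// mulr0.
Qed.

Lemma bsuppB f g : bsupp f -> bsupp g -> bsupp (fun x => f x - g x).
Proof.
move=> [mf [M fM] [r fr]] [mg [N gN] [s gs]]; split.
- exact: measurable_funB.
- by exists (M + N) => x; apply: le_trans (ler_normB _ _) _; exact: lerD.
- by exists (Num.max r s) => x; rewrite gt_max => /andP[? ?]; rewrite fr// gs// subrr.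
Qed.

Lemma bsupp_shift (a : 'rV[R]_n) f : bsupp f -> bsupp (fun x => f (x + a)).
Proof.
move=> [mf [M fM] [r fr]]; split.
- exact: (measurableT_comp mf (measurable_shift_rV a)).
- by exists M.
- exists (r + enorm a) => x xr; apply: fr.
  have : enorm x <= enorm (x + a) + enorm a.
    by rewrite -{1}(addrK a x); apply: le_trans (enormD _ _) _; rewrite enormN.
  by move: xr; lra.
Qed.

Lemma bsupp_integrable f : bsupp f -> mu.-integrable setT (EFin \o f).
Proof.
move=> [mf [M fM] [r fr]].
pose D := [set x : 'rV[R]_n | enorm x <= r].
have mD : measurable D.
  rewrite -[D]setCK; apply: measurableC; apply: measurable_open_rV.
  by apply: closed_openC; exact: closed_enorm_ball.
have -> : EFin \o f = (EFin \o f) \_ D.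
  apply/funext => x; rewrite patchE; case: ifPn => // /negP xD.
  rewrite /= fr// ltNge; apply/negP => xr; apply: xD; exact/mem_set.
apply/(integrable_mkcond _ mD); apply: integrable_bounded => //.
- exact: bounded_enorm_ball.
- exact: measurable_funS mf.
- by exists M.
Qed.

Lemma Rintegral_shift (a : 'rV[R]_n) f : bsupp f ->
  \int[mu]_x f (x + a) = \int[mu]_x f x.
Proof.
move=> bf; have [mf _ _] := bf; rewrite /Rintegral; congr fine.
have := @integral_pushforward _ _ _ _ R _ (measurable_shift_rV a) mu setT (EFin \o f).
move=> <- //.
- apply: eq_measure_integral => [|? A mA _]; first exact: measurable_shift_rV.
  exact: (@lebesgue_rV_shift R n a A mA).
- exact/measurable_EFinP.
- exact: (bsupp_integrable (bsupp_shift a bf)).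
Qed.

Lemma Rintegral_dominated_cvg D (f_ : nat -> 'rV[R]_n -> R) f g :
  measurable D -> (forall k, measurable_fun D (f_ k)) ->
  (forall x, D x -> f_ k x @[k --> \oo] --> f x) ->
  mu.-integrable D (EFin \o g) -> (forall k x, D x -> `|f_ k x| <= g x) ->
  \int[mu]_(x in D) f_ k x @[k --> \oo] --> \int[mu]_(x in D) f x.
Proof.
move=> mD mf ff ig fg.
have mlim : measurable_fun D f by exact: measurable_fun_cvg ff.
have iflim : mu.-integrable D (EFin \o f).
  apply: (le_integrable mD _ _ ig); first exact/measurable_EFinP.
  move=> x Dx /=; rewrite lee_fin [leRHS]ger0_norm; last first.
    exact: le_trans (fg 0%N x Dx).
  have h := cvg_norm (FF := eventually_filter) (ff x Dx).
  rewrite -(cvg_lim _ h)//; apply: limr_le; first by apply/cvg_ex; eexists; exact: h.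
  by apply: nearW => k; exact: fg.
apply: fine_cvg; rewrite fineK; last exact: integrable_fin_num.
apply: (@dominated_cvg _ _ _ mu D mD (fun k => EFin \o f_ k) _ (EFin \o g)) => //.
- by move=> k; exact/measurable_EFinP.
- by move=> x Dx; apply: cvg_EFin; [exact: nearW|exact: ff].
Qed.

End bounded_support.

(** * Weak gradients of Lipschitz functions *)

Section weak_gradient_lipschitz.
Context {R : realType} {n : nat}.
Local Notation mu := (@lebesgue_rV R n).
Implicit Types (f g u psi : 'rV[R]_n -> R) (Om : set 'rV[R]_n).

Lemma Lnormy_le (h : 'rV[R]_n -> \bar R) (M : \bar R) : (0 <= M)%E ->
  {ae mu, forall x, `|h x|%E <= M}%E -> (Lnorm mu +oo%E h <= M)%E.
Proof. by move=> M0 hM; rewrite unlock; case: ifPn => // _; apply/ess_supP. Qed.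

Lemma Linfty_bounded Om f : measurable Om -> measurable_fun Om f ->
  (exists M, forall x, Om x -> `|f x| <= M) -> Linfty Om f.
Proof.
move=> mO mf [M fM]; rewrite /Linfty inE; apply/andP; split.
  by rewrite inE/=; apply/(measurable_restrict _ mO measurableT); rewrite setTI.
rewrite inE/= /finite_norm; apply: (@le_lt_trans _ _ (`|M|)%:E); last exact: ltry.
apply: Lnormy_le => //; apply: aeW => x /=; rewrite lee_fin patchE.
case: ifPn => [|_]; last by rewrite normr0.
by rewrite inE => Ox; apply: le_trans (fM x Ox) (ler_norm _).
Qed.

Lemma Rintegral_supp Om f : (forall x, ~ Om x -> f x = 0) ->
  \int[mu]_(x in Om) f x = \int[mu]_x f x.
Proof.
move=> f0; rewrite Rintegral_mkcond; congr (Rintegral _ _ _).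
apply/funext => x; rewrite patchE; case: ifPn => // /negP xO.
by rewrite f0// => Ox; apply: xO; exact/mem_set.
Qed.

Lemma bsupp_compact K g : compact K -> continuous g ->
  (forall x, ~ K x -> g x = 0) -> bsupp g.
Proof.
move=> cK cg gK.
have /ex_strict_bound_gt0[M M0 hM] :=
  compact_bounded (continuous_compact (continuous_subspaceT cg) cK).
have [r r0 hr] := bounded_enorm (compact_bounded cK).
split; first exact: measurable_continuous.
- exists M => x; have [Kx|Kx] := pselect (K x); last by rewrite gK// normr0 ltW.
  by apply/ltW/(hM (g x)); exists x.
- by exists r => x xr; apply: gK => /hr; rewrite leNgt xr.
Qed.

Lemma bsupp_ball r (M : R) : bsupp ((cst M) \_ [set x : 'rV[R]_n | enorm x <= r]).
Proof.
split.
- apply/measurable_restrict => //.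
  rewrite -[X in measurable X]setCK; apply: measurableC; apply: measurable_open_rV.
  by apply: closed_openC; exact: closed_enorm_ball.
- exists `|M| => x; rewrite patchE; case: ifPn => // _; by rewrite normr0.
- exists r => x xr; rewrite patchE memNset//= => xr'.
  by rewrite ltNge xr' in xr.
Qed.

Lemma continuous_shift (a : 'rV[R]_n) f : continuous f ->
  continuous (fun x : 'rV[R]_n => f (x + a)).
Proof.
move=> cf x; apply: (@continuous_comp _ _ _ (fun y : 'rV[R]_n => y + a) f x); last exact: cf.
by apply: (@cvgD _ _ _ (nbhs x) _ id (cst a)); [exact: cvg_id|exact: cvg_cst].
Qed.

Lemma continuous_quot u w k : continuous u -> continuous (fun x => quot u x w k).
Proof.
move=> cu; apply: continuous_mulr; first exact: cst_continuous.
by apply: continuous_subr => //; exact: continuous_shift.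
Qed.

Lemma bsupp_quot f w k : bsupp f -> bsupp (fun x => quot f x w k).
Proof.
move=> bf; apply: (bsuppM (g := cst k.+1%:R)); first exact/lbdd_continuous/cst_continuous.
by apply: bsuppB => //; exact: bsupp_shift.
Qed.

(** Discrete integration by parts: a change of variable moves the step from u to psi and reverses
    its direction. *)
Lemma Rintegral_quot u psi w k : continuous u -> bsupp psi ->
  \int[mu]_x (quot u x w k * psi x) = \int[mu]_x (u x * quot psi x (- w) k).
Proof.
move=> cu bp; set a := step k *: w.
have lu := lbdd_continuous cu.
have b1 : bsupp (fun x => u (x + a) * psi x).
  by apply: bsuppM => //; apply: lbdd_continuous; exact: continuous_shift.
have b2 : bsupp (fun x => u x * psi x) by exact: bsuppM.
have b3 : bsupp (fun x => u x * psi (x - a)).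
  by apply: bsuppM => //; exact: (bsupp_shift (- a)).
transitivity (k.+1%:R * (\int[mu]_x (u (x + a) * psi x) - \int[mu]_x (u x * psi x))).
  rewrite -RintegralB//; [|exact: bsupp_integrable b1|exact: bsupp_integrable b2].
  rewrite -RintegralZl//; last exact: (bsupp_integrable (bsuppB b1 b2)).
  by apply: eq_Rintegral => x _; rewrite /quot -/a -mulrBl mulrA.
rewrite -(Rintegral_shift (- a) b1).
transitivity (k.+1%:R * (\int[mu]_x (u x * psi (x - a)) - \int[mu]_x (u x * psi x))).
  by congr (_ * (_ - _)); apply: eq_Rintegral => x _; rewrite subrK.
rewrite -RintegralB//; [|exact: bsupp_integrable b3|exact: bsupp_integrable b2].
rewrite -RintegralZl//; last exact: (bsupp_integrable (bsuppB b3 b2)).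
by apply: eq_Rintegral => x _; rewrite /quot scalerN -/a -mulrBr mulrCA.
Qed.

Section test.
Variables (Om : set 'rV[R]_n) (psi : 'rV[R]_n -> R).
Hypothesis tpsi : test_function Om psi.
Let K := closure [set x | psi x != 0].
Implicit Type i : 'I_n.

Lemma test_continuous : continuous psi.
Proof. by have [/(_ [::])[]] := tpsi. Qed.

Lemma test_derivable x i : derivable psi x (delta_mx ord0 i).
Proof. by have [/(_ [::])[_ /(_ x i)]] := tpsi. Qed.

Lemma test_partial_continuous i : continuous (partial i psi).
Proof. by have [/(_ [:: i])[]] := tpsi. Qed.

Let psi0 x : ~ K x -> psi x = 0.
Proof.
move=> Kx; apply: contrapT => /eqP px; apply: Kx; exact: subset_closure.
Qed.

Let partial0 i x : ~ K x -> partial i psi x = 0.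
Proof.
move=> Kx; have oK : open (~` K) by apply: closed_openC; exact: closed_closure.
rewrite /partial (@near_eq_derive _ _ _ psi (cst 0)); first exact: derive_cst.
have := open_nbhs_nbhs (conj oK Kx); apply: filterS => y /psi0 ->.
by [].
Qed.

Lemma bsupp_test : bsupp psi.
Proof. have [_ cK _] := tpsi; exact: bsupp_compact cK test_continuous psi0. Qed.

Lemma bsupp_test_partial i : bsupp (partial i psi).
Proof.
have [_ cK _] := tpsi; apply: bsupp_compact cK _ _; first exact: test_partial_continuous.
exact: partial0.
Qed.

Lemma test_eq0 x : ~ Om x -> psi x = 0.
Proof. by have [_ _ KO] := tpsi; move=> Ox; apply: psi0 => /KO. Qed.

Lemma test_partial_eq0 i x : ~ Om x -> partial i psi x = 0.
Proof. by have [_ _ KO] := tpsi; move=> Ox; apply: partial0 => /KO. Qed.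

Lemma is_derive_test_line x i (s : R) :
  is_derive s 1 (fun s => psi (x + s *: delta_mx ord0 i))
    (partial i psi (x + s *: delta_mx ord0 i)).
Proof.
set e := delta_mx ord0 i; set y := x + s *: e.
have E : (fun h => h^-1 *: (((fun s => psi (x + s *: e)) \o shift s) (h *: 1) - psi (x + s *: e)))
    = (fun h : R => h^-1 *: ((psi \o shift y) (h *: e) - psi y)).
  apply/funext => h; rewrite /= -/y; congr (_ *: (psi _ - _)).
  by rewrite /y scalerDl /GRing.scale/= mulr1 addrC addrAC addrA.
apply: DeriveDef; first by rewrite /derivable E; exact: test_derivable.
by rewrite /derive E.
Qed.

Lemma cvg_quot_test x i :
  quot psi x (- delta_mx ord0 i) k @[k --> \oo] --> - partial i psi x.
Proof.
have /cvgr_dnbhsP h := test_derivable (x := x) (i := i).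
have -> : quot psi x (- delta_mx ord0 i) =
    fun k => - ((- step k)^-1 *: (psi (- step k *: delta_mx ord0 i + x) - psi x)).
  apply/funext => k; rewrite /quot /step invrN invrK scaleNr opprK.
  by rewrite scalerN scaleNr [- _ + x]addrC.
apply: cvgN; apply: h; split.
  by move=> k; rewrite oppr_eq0 gt_eqF// step_gt0.
by rewrite -oppr0; apply: cvgN; exact: cvg_step.
Qed.

(** The mean value theorem bounds the quotients by the supremum of the partial derivative, uniformly
    in k, as domination requires. *)
Lemma quot_test_bounded i : exists2 M, 0 <= M &
  forall k x, `|quot psi x (- delta_mx ord0 i) k| <= M.
Proof.
have [_ [M hM] _] := bsupp_test_partial i.
exists M; first exact: le_trans (hM 0).
move=> k x; set e := delta_mx ord0 i; pose F s := psi (x + s *: e).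
have dF (s : R) : is_derive s 1 F (partial i psi (x + s *: e)) by exact: is_derive_test_line.
have h0 : - (step k : R) < 0 by rewrite oppr_lt0 step_gt0.
have cF : {within `[(- step k), 0], continuous F}.
  by apply: derivable_within_continuous => s _; have [] := dF s.
have [c _] := MVT h0 (fun s _ => dF s) cF.
rewrite /F scale0r addr0 sub0r opprK => E.
rewrite /quot scalerN -scaleNr -opprB E /step mulrN normrN mulrC divfK//.
Qed.

End test.

(** Both sides of the discrete integration by parts pass to the limit. One-sided derivatives of u
    suffice, since the backward quotients fall on the smooth psi. *)
Lemma weak_gradient_quot Om u (G : 'rV[R]_n -> 'rV[R]_n) : open Om -> lip1 u ->
  (forall x i, Om x -> quot u x (delta_mx ord0 i) k @[k --> \oo] --> G x ord0 i) ->
  weak_gradient Om u G.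
Proof.
move=> oO lu hG i psi tp; pose e : 'rV[R]_n := delta_mx ord0 i.
have cu := lip1_continuous lu.
have mO := measurable_open_rV oO.
have bp := bsupp_test tp; have bdp := bsupp_test_partial tp i.
pose A k := \int[mu]_x (quot u x e k * psi x).
have A1 : A k @[k --> \oo] --> \int[mu]_(x in Om) (G x ord0 i * psi x).
  have -> : A = fun k => \int[mu]_(x in Om) (quot u x e k * psi x).
    apply/funext => k; rewrite Rintegral_supp// => x Ox.
    by rewrite (test_eq0 tp Ox) mulr0.
  apply: (@Rintegral_dominated_cvg _ _ _ _ _ (fun x => `|psi x|)) => //.
  - move=> k; apply: measurable_funTS; apply: measurable_continuous.
    by apply: continuous_mulr; [exact: continuous_quot|exact: test_continuous tp].
  - by move=> x Ox; apply: cvgM; [exact: hG|exact: cvg_cst].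
  - apply: (@integrableS _ _ _ _ setT) => //.
    by apply: integrable_norm; exact: bsupp_integrable.
  - move=> k x Ox; rewrite normrM ler_piMl//.
    by apply: le_trans (norm_quot_le _ _ _ lu) _; rewrite enorm_delta.
have A2 : A k @[k --> \oo] --> - (\int[mu]_(x in Om) (u x * partial i psi x)).
  have -> : - (\int[mu]_(x in Om) (u x * partial i psi x)) =
      \int[mu]_x (u x * - partial i psi x).
    rewrite Rintegral_supp; last by move=> x Ox; rewrite (test_partial_eq0 tp i Ox) mulr0.
    rewrite -mulN1r -RintegralZl//.
      by apply: eq_Rintegral => x _; rewrite mulN1r mulrN.
    by apply: bsupp_integrable; apply: bsuppM => //; exact: lbdd_continuous.
  have -> : A = fun k => \int[mu]_x (u x * quot psi x (- e) k).
    by apply/funext => k; exact: Rintegral_quot.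
  have [M M0 hM] := quot_test_bounded tp i.
  have [_ _ [r hr]] := bp.
  (* All steps are at most 1, so a ball one unit larger contains the supports of all the quotients
     of psi. *)
  pose b := (cst M) \_ [set x : 'rV[R]_n | enorm x <= r + 1].
  have bb : bsupp b := @bsupp_ball _ _.
  have bub : bsupp (fun x => u x * b x).
    by apply: bsuppM => //; exact: lbdd_continuous.
  apply: (@Rintegral_dominated_cvg _ _ _ _ _ (fun x => `|u x * b x|)) => //.
  - move=> k; have [] // := bsuppM (lbdd_continuous cu) (bsupp_quot (- e) k bp).
  - by move=> x _; apply: cvgM; [exact: cvg_cst|exact: (cvg_quot_test tp)].
  - by apply: integrable_norm; exact: bsupp_integrable.
  - move=> k x _; rewrite normrM [leRHS]normrM ler_wpM2l//.
    rewrite /b patchE; case: ifPn => [_|]; first by rewrite (ger0_norm M0).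
    move=> /negP xr; have {}xr : r + 1 < enorm x.
      by rewrite ltNge; apply/negP => h; apply: xr; exact/mem_set.
    rewrite normr0 /quot !hr ?subrr ?mulr0 ?normr0//; first lra.
    have : enorm x <= enorm (x + step k *: - e) + step k.
      rewrite -{1}(addrK (step k *: - e) x); apply: le_trans (enormD _ _) _.
      by rewrite enormN enormZ enormN enorm_delta mulr1 gtr0_norm ?step_gt0.
    have := @step_le1 R k; lra.
have := cvg_unique _ A1 A2 => ->; rewrite ?opprK//.
Qed.

End weak_gradient_lipschitz.

(** * The gradient bound for tame functions *)

Section lipschitz_sobolev.
Context {R : realType} {n : nat}.
Local Notation mu := (@lebesgue_rV R n).
Implicit Types (f g u psi : 'rV[R]_n -> R) (Om D : set 'rV[R]_n).

Lemma Rintegral_ge0_eq0 D f : measurable D -> mu.-integrable D (EFin \o f) ->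
  {ae mu, forall x, D x -> 0 <= f x} -> \int[mu]_(x in D) f x = 0 ->
  {ae mu, forall x, D x -> f x = 0}.
Proof.
move=> mD intf f0 If; have mf := measurable_int mu intf.
suff : (\int[mu]_(x in D) `|(EFin \o f) x| = 0)%E.
  move/(ae_eq_integral_abs mu mD mf); apply: filterS => x h Dx.
  by have [] := h Dx.
rewrite (ae_eq_integral (EFin \o f)) //.
- by rewrite -[LHS]fineK ?integrable_fin_num//; congr EFin.
- exact: measurableT_comp.
- by apply: filterS f0 => x h Dx; rewrite /= ger0_norm// h.
Qed.

Section fixed.
Variables (Om : set 'rV[R]_n) (u : 'rV[R]_n -> R).
Hypotheses (oO : open Om) (bO : bounded_set Om) (bne : boundary Om !=set0).
Hypotheses (lu : lip1 u) (tu : forall x, Om x -> tame u x).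

Let d0 : 'rV[R]_n -> R := (dist_boundary Om) \_ Om.

Let d0_out x : ~ Om x -> d0 x = 0.
Proof. by move=> Ox; rewrite /d0 patchE memNset. Qed.

Let d0_in x : Om x -> d0 x = dist_boundary Om x.
Proof. by move=> Ox; rewrite /d0 patchE mem_set. Qed.

Let lip1_d0 : lip1 d0.
Proof.
move=> x y; have [Ox|Ox] := pselect (Om x); have [Oy|Oy] := pselect (Om y).
- by rewrite !d0_in//; exact: lip1_dist.
- rewrite (d0_out Oy) subr0 d0_in// leNgt enorm_distC; apply/negP => h.
  by apply: Oy; exact: dist_ball Ox h.
- rewrite (d0_out Ox) d0_in// sub0r; apply: (@le_trans _ _ 0); last exact: enorm_ge0.
  by rewrite oppr_le0 dist_ge0.
- by rewrite !d0_out// subrr enorm_ge0.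
Qed.

Let bsupp_d0 : bsupp d0.
Proof.
have [M M0 hM] := bounded_enorm bO.
have h x : M < enorm x -> d0 x = 0.
  by move=> xM; apply: d0_out => /hM; rewrite leNgt xM.
apply: (@bsupp_compact _ _ [set x | enorm x <= M]).
- by apply: bounded_closed_compact; [exact: bounded_enorm_ball|exact: closed_enorm_ball].
- exact: lip1_continuous.
- by move=> x /= /negP; rewrite -ltNge; exact: h.
Qed.

Let measurable_limn_quot w : measurable_fun Om (fun x => limn (quot u x w)).
Proof.
apply: (measurable_fun_cvg (h := fun k x => quot u x w k)).
- move=> k; apply: measurable_funTS; apply: measurable_continuous.
  by apply: continuous_quot; exact: lip1_continuous.
- by move=> x Ox; have [+ _] := tu Ox; exact.
Qed.

Let limn_quot_le w x : Om x -> `|limn (quot u x w)| <= enorm w.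
Proof.
move=> Ox; have [/(_ w) h _] := tu Ox.
have h' := cvg_norm (FF := eventually_filter) h.
rewrite -(cvg_lim _ h')//; apply: limr_le; first by apply/cvg_ex; eexists; exact: h'.
by apply: nearW => k; exact: norm_quot_le.
Qed.

(* Testing with the distance to the complement of [Om], a Lipschitz function
   positive exactly on [Om], shows that the two one-sided derivatives agree. *)
Lemma limn_quot_opp i : {ae mu, forall x, Om x ->
  limn (quot u x (delta_mx ord0 i)) + limn (quot u x (- delta_mx ord0 i)) = 0}.
Proof.
pose e : 'rV[R]_n := delta_mx ord0 i; have mO := measurable_open_rV oO.
have cu := lip1_continuous lu.
have id0 : mu.-integrable Om (fun x => `|d0 x|%:E).
  apply: (@integrableS _ _ _ _ setT) => //.
  by apply: integrable_norm; exact: bsupp_integrable.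
have e1 : enorm e = 1 by exact: enorm_delta.
pose A w k := \int[mu]_x (quot u x w k * d0 x).
have cvgA w : enorm w = 1 ->
    A w k @[k --> \oo] --> \int[mu]_(x in Om) (limn (quot u x w) * d0 x).
  move=> w1; have -> : A w = fun k => \int[mu]_(x in Om) (quot u x w k * d0 x).
    by apply/funext => k; rewrite Rintegral_supp// => x /d0_out ->; rewrite mulr0.
  apply: (@Rintegral_dominated_cvg _ _ _ _ _ (fun x => `|d0 x|)) => //.
  - move=> k; apply: measurable_funTS; apply: measurable_continuous.
    by apply: continuous_mulr; [exact: continuous_quot|exact: lip1_continuous].
  - move=> x Ox; apply: cvgM; last exact: cvg_cst.
    by have [+ _] := tu Ox; exact.
  - move=> k x Ox; rewrite normrM ler_piMl// -w1.
    exact: norm_quot_le.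
(* The sum of opposite derivatives is at most q.e - q.e = 0, so F is nonnegative and a vanishing
   integral makes it vanish almost everywhere. *)
pose F x := - ((limn (quot u x e) + limn (quot u x (- e))) * d0 x).
have mF : measurable_fun Om F.
  apply: measurableT_comp => //; apply: measurable_funM.
    by apply: measurable_funD; exact: measurable_limn_quot.
  by apply: measurable_funTS; apply: measurable_continuous; exact: lip1_continuous.
have int w : enorm w = 1 ->
    mu.-integrable Om (EFin \o (fun x => limn (quot u x w) * d0 x)).
  move=> w1; apply: (le_integrable mO _ _ id0).
    apply/measurable_EFinP; apply: measurable_funM; first exact: measurable_limn_quot.
    by apply: measurable_funTS; apply: measurable_continuous; exact: lip1_continuous.
  move=> x Ox /=; rewrite lee_fin normrM normr_id ler_piMl// -w1.
  exact: limn_quot_le.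
have IF : \int[mu]_(x in Om) F x = 0.
  have en1 : enorm (- e) = 1 by rewrite enormN.
  have -> : \int[mu]_(x in Om) F x =
     - (\int[mu]_(x in Om) (limn (quot u x e) * d0 x) +
        \int[mu]_(x in Om) (limn (quot u x (- e)) * d0 x)).
    rewrite -RintegralD//; [|exact: int..].
    rewrite -mulN1r -RintegralZl//.
      by apply: eq_Rintegral => x _; rewrite /F mulrDl mulN1r.
    have := integrableD mO (int _ e1) (int _ en1).
    by apply: eq_integrable.
  apply/eqP; rewrite oppr_eq0; apply/eqP.
  apply: (@cvg_unique _ _ (A e k + A (- e) k @[k --> \oo])) => //.
    exact: (cvgD (cvgA _ e1) (cvgA _ en1)).
  have [_ _ [r hr]] := bsupp_d0.
  pose b := (cst (1 : R)) \_ [set x : 'rV[R]_n | enorm x <= r + 1].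
  have bb : bsupp b := @bsupp_ball _ _ _ _.
  (* The backward quotient at x + a is minus the forward one at x. After a shift, the sum is the
     integral of q (d0(x) - d0(x + a)), where |q| <= 1 and d0 varies by at most |a| = [step k]. *)
  have bd k : `|A e k + A (- e) k| <= step k * \int[mu]_x b x.
    pose q x := quot u x e k.
    have cq : continuous q by exact: continuous_quot.
    set a := step k *: e.
    have b1 : bsupp (fun x => q x * d0 x) by apply: bsuppM => //; exact: lbdd_continuous.
    have b2 : bsupp (fun x => q x * d0 (x + a)).
      by apply: bsuppM; [exact: lbdd_continuous|exact: bsupp_shift].
    have E : A e k + A (- e) k = \int[mu]_x (q x * (d0 x - d0 (x + a))).
      have -> : A (- e) k = - \int[mu]_x (q x * d0 (x + a)).
        rewrite -(Rintegral_shift (- a) b2) -mulN1r -RintegralZl//; last first.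
          exact: bsupp_integrable (bsupp_shift _ b2).
        apply: eq_Rintegral => x _; rewrite mulN1r subrK -mulNr; congr (_ * _).
        by rewrite /q /quot scalerN -/a subrK -mulrN opprB.
      rewrite -RintegralB//; [|exact: bsupp_integrable b1|exact: bsupp_integrable b2].
      by apply: eq_Rintegral => x _; rewrite mulrBr.
    have b3 : bsupp (fun x => q x * (d0 x - d0 (x + a))).
      by apply: bsuppM; [exact: lbdd_continuous|apply: bsuppB => //; exact: bsupp_shift].
    rewrite E -RintegralZl//; last exact: bsupp_integrable.
    apply: le_trans (le_normr_Rintegral _ _) _ => //; first exact: bsupp_integrable.
    apply: le_Rintegral => //.
    - by apply: integrable_norm; exact: bsupp_integrable.
    - apply: bsupp_integrable; apply: bsuppM => //.
      exact/lbdd_continuous/cst_continuous.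
    have aE : enorm a = step k by rewrite enormZ e1 mulr1 gtr0_norm// step_gt0.
    move=> x _; rewrite /b patchE; case: ifPn => [_|].
      rewrite mulr1 normrM -[leRHS]mul1r; apply: ler_pM => //.
        by rewrite -e1; exact: norm_quot_le.
      apply: le_trans (lip1_norm _ _ lip1_d0) _.
      by rewrite opprD addrA subrr add0r enormN aE.
    move=> /negP xr; have {}xr : r + 1 < enorm x.
      by rewrite ltNge; apply/negP => h; apply: xr; exact/mem_set.
    have -> : point = 0 :> R by [].
    have xa : r < enorm (x + a).
      have : enorm x <= enorm (x + a) + step k.
        rewrite -{1}(addrK a x); apply: le_trans (enormD _ _) _.
        by rewrite enormN aE.
      have := @step_le1 R k; lra.
    rewrite (hr _ xa) hr; last lra.
    by rewrite subrr !mulr0 normr0.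
  apply: norm_cvg0.
  apply: (@squeeze_cvgr _ _ _ _ (cst 0) (fun k => step k * \int[mu]_x b x)).
  - by apply: nearW => k; rewrite normr_ge0 bd.
  - exact: cvg_cst.
  - rewrite -(mul0r (\int[mu]_x b x)); apply: cvgM; [exact: cvg_step|exact: cvg_cst].
have F0 x : Om x -> 0 <= F x.
  move=> Ox; rewrite /F d0_in// -mulNr mulr_ge0 ?dist_ge0// oppr_ge0.
  have [_ [q _ hq]] := tu Ox.
  have := hq e; have := hq (- e); rewrite dotNr; lra.
have intF : mu.-integrable Om (EFin \o F).
  apply: integrable_bounded => //.
  have [_ [M hM] _] := bsupp_d0; exists (2 * M) => x Ox.
  rewrite /F normrN normrM ler_pM//.
  apply: le_trans (ler_normD _ _) _.
  have := limn_quot_le e Ox; have := limn_quot_le (- e) Ox.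
  rewrite enormN e1; lra.
have := Rintegral_ge0_eq0 mO intF (aeW _ F0) IF; apply: filterS => x h Ox.
have := h Ox; rewrite /F d0_in// => /eqP; rewrite oppr_eq0 mulf_eq0.
by rewrite (gt_eqF (dist_gt0 bne oO bO Ox)) orbF => /eqP.
Qed.

Lemma tame_W1infty : exists2 G, W1infty Om u G & (Linfty_norm Om (enorm \o G) <= 1)%E.
Proof.
have mO := measurable_open_rV oO.
pose G x : 'rV[R]_n := \row_i limn (quot u x (delta_mx ord0 i)).
have GE x i : G x ord0 i = limn (quot u x (delta_mx ord0 i)) by rewrite mxE.
exists G.
  split.
  - apply: Linfty_bounded => //.
      by apply: measurable_funTS; apply: measurable_continuous; exact: lip1_continuous.
    have [M M0 hM] := bounded_enorm bO.
    have [_ /(_ M)[N hN]] := lbdd_continuous (lip1_continuous lu).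
    by exists N => x /hM; exact: hN.
  - move=> i; apply: Linfty_bounded => //.
      by under eq_fun do rewrite GE; exact: measurable_limn_quot.
    by exists 1 => x Ox; rewrite GE -(enorm_delta (R := R) i); exact: limn_quot_le.
  - apply: weak_gradient_quot => // x i Ox; rewrite GE.
    by have [+ _] := tu Ox; exact.
apply: Lnormy_le => //.
have h : {ae mu, forall x, forall i, Om x ->
    limn (quot u x (delta_mx ord0 i)) + limn (quot u x (- delta_mx ord0 i)) = 0}.
  by apply: filter_forall => i; exact: limn_quot_opp.
apply: filterS h => x hx /=; rewrite lee_fin patchE.
case: ifPn => [|_]; last by rewrite normr0.
rewrite inE => Ox; rewrite ger0_norm ?enorm_ge0//=.
have [_ [q q1 hq]] := tu Ox.
(* Both one-sided derivatives along e_i are dominated, by q_i and -q_i, and their sum is 0; so each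
   domination is an equality. *)
suff -> : G x = q by [].
apply/rowP => i; rewrite GE; apply/eqP; rewrite eq_le.
have := hx i Ox; have := hq (delta_mx ord0 i); have := hq (- delta_mx ord0 i).
rewrite dotNr dot_delta => h1 h2 h3; apply/andP; split; lra.
Qed.

End fixed.
End lipschitz_sobolev.

(** * Lipschitz bound for traces *)

Section trace_lipschitz.
Context {R : realType} {n : nat}.
Local Notation mu := (@lebesgue_rV R n).
Implicit Types (f g psi : 'rV[R]_n -> R) (Om U D : set 'rV[R]_n).

(** A nonempty open set contains a cube of positive measure, so no null set covers it. *)
Lemma ae_open_point U (P : 'rV[R]_n -> Prop) x : open U -> U x ->
  {ae mu, forall y, P y} -> exists2 y, U y & P y.
Proof.
move=> oU Ux [N [mN N0 PN]]; apply: contrapT => noP.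
have UN : U `<=` N.
  by move=> y Uy; apply: PN => /= Py; apply: noP; exists y.
have [r r0 rU] := open_enormP oU Ux.
pose s := r / (2 * n.+1%:R).
have s0 : 0 < s by rewrite divr_gt0 ?mulr_gt0.
pose C := [set v : 'rV[R]_n | forall i, `|v ord0 i - x ord0 i| <= s].
have CU : C `<=` U.
  move=> v Cv; apply: rU; apply: le_lt_trans (enorm_le_normr _) _.
  apply: (@le_lt_trans _ _ (n.+1%:R * s)).
    apply: ler_pM => //; first by rewrite ler_nat.
    rewrite normr_rV_le ?(ltW s0)//; apply/forallP => i.
    by rewrite !mxE; exact: Cv.
  have -> : n.+1%:R * s = r / 2 by rewrite /s; field; rewrite nat1r pnatr_eq0.
  by rewrite ltr_pdivrMr// ltr_pMr// ltr1n.
have : (mu C <= mu N)%E.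
  by apply: le_measure; rewrite ?inE//; [exact: measurable_cube|exact: subset_trans UN].
rewrite N0 /C lebesgue_rV_cube ?(ltW s0)// lee_fin leNgt exprn_gt0//.
by rewrite mulr_gt0.
Qed.

(** [Lnorm] at exponent +oo is the essential supremum only on a space of positive measure. *)
Lemma lebesgue_rV_setT_gt0 : (0 < mu setT)%E.
Proof.
rewrite lt0e measure_ge0 andbT; apply/negP => /eqP T0.
have : {ae mu, forall y : 'rV[R]_n, False} by exists setT; split.
by move=> /(ae_open_point (x := 0) openT I)[].
Qed.

Lemma ae_le_Lnormy (h : 'rV[R]_n -> \bar R) M : (Lnorm mu +oo%E h <= M)%E ->
  {ae mu, forall x, `|h x|%E <= M}%E.
Proof. by rewrite unlock lebesgue_rV_setT_gt0 => /ess_supP. Qed.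

Lemma Linfty_measurable Om g : measurable Om -> Linfty Om g -> measurable_fun Om g.
Proof.
move=> mO; rewrite /Linfty inE => /andP[+ _]; rewrite inE/= => mg.
have [_] := measurable_restrict g mO mO; rewrite setIid; apply.
exact: measurable_funTS.
Qed.

Lemma Linfty_ae Om g : Linfty Om g ->
  exists M, {ae mu, forall x, Om x -> `|g x| <= M}.
Proof.
rewrite /Linfty inE => /andP[_]; rewrite inE/= /finite_norm.
have := Lnorm_ge0 mu +oo%E (EFin \o g \_ Om).
case E : (Lnorm mu +oo%E (EFin \o g \_ Om)) => [M| |]// _ _; exists M.
have : (Lnorm mu +oo%E (EFin \o g \_ Om) <= M%:E)%E by rewrite E.
move=> /ae_le_Lnormy; apply: filterS => x /= + Ox.
by rewrite lee_fin patchE mem_set.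
Qed.

Lemma integrable_ae_bounded Om g : measurable Om -> bounded_set Om ->
  measurable_fun Om g -> (exists M, {ae mu, forall x, Om x -> `|g x| <= M}) ->
  mu.-integrable Om (EFin \o g).
Proof.
move=> mO bO mg [M hM].
apply/integrableP; split; first exact/measurable_EFinP.
apply: (@le_lt_trans _ _ (`|M|%:E * mu Om)%E).
  apply: integral_le_bound => //; first exact/measurable_EFinP.
  by apply: filterS hM => x h Ox; rewrite lee_fin (le_trans (h Ox))// ler_norm.
by rewrite lte_mul_pinfty//; exact: lebesgue_rV_bounded.
Qed.

Lemma Linfty_integrable Om g : measurable Om -> bounded_set Om -> Linfty Om g ->
  mu.-integrable Om (EFin \o g).
Proof.
move=> mO bO hg; apply: integrable_ae_bounded => //; first exact: Linfty_measurable.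
exact: Linfty_ae.
Qed.

Lemma Linfty_integrableM Om f g : measurable Om -> bounded_set Om ->
  Linfty Om f -> Linfty Om g -> mu.-integrable Om (EFin \o (fun x => f x * g x)).
Proof.
move=> mO bO hf hg; apply: integrable_ae_bounded => //.
  by apply: measurable_funM; exact: Linfty_measurable.
have [M hM] := Linfty_ae hf; have [N hN] := Linfty_ae hg.
exists (M * N); apply: filterS2 hM hN => x h1 h2 Ox.
by rewrite normrM; apply: ler_pM => //; [exact: h1|exact: h2].
Qed.

Lemma integrableM_bounded Om g (h : 'rV[R]_n -> R) : measurable Om -> mu.-integrable Om (EFin \o g) ->
  measurable_fun setT h -> (exists M, forall x, `|h x| <= M) ->
  mu.-integrable Om (EFin \o (fun x => g x * h x)).
Proof.
move=> mO ig mh [M hM].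
have mh' : measurable_fun Om h by exact: measurable_funTS.
have := integrableMl mO ig mh' (bounded_le (fun x (_ : Om x) => hM x)).
by apply: eq_integrable.
Qed.

Lemma ae_le_Rintegral D f g : measurable D ->
  mu.-integrable D (EFin \o f) -> mu.-integrable D (EFin \o g) ->
  {ae mu, forall x, D x -> f x <= g x} ->
  \int[mu]_(x in D) f x <= \int[mu]_(x in D) g x.
Proof.
move=> mD intf intg [N [mN N0 fgN]].
rewrite /Rintegral !(negligible_integral mN mD)//.
have mDN : measurable (D `\` N) by exact: measurableD.
apply: le_Rintegral => //.
- by apply: integrableS intf => //; exact: subDsetl.
- by apply: integrableS intg => //; exact: subDsetl.
- move=> x [Dx Nx]; apply: contrapT => fg; apply: Nx; apply: fgN => /=.
  by move=> /(_ Dx).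
Qed.

Section fixed.
Variables (Om : set 'rV[R]_n) (phi : 'rV[R]_n -> R) (G : 'rV[R]_n -> 'rV[R]_n)
  (t : 'rV[R]_n -> R).
Hypotheses (oO : open Om) (bO : bounded_set Om) (W : W1infty Om phi G)
  (G1 : (Linfty_norm Om (enorm \o G) <= 1)%E) (ht : has_trace Om phi t).

Let mO : measurable Om := measurable_open_rV oO.

Lemma trace_continuous x : Om x -> {for x, continuous t}.
Proof.
move=> Ox; have [ct _] := ht.
have := continuous_subspaceW (@subset_closure _ Om) ct.
by rewrite continuous_open_subspace// => /(_ x); apply; rewrite inE.
Qed.

Lemma trace_measurable : measurable_fun Om t.
Proof.
apply: continuous_measurable_rV => // x; rewrite inE => Ox.
exact: trace_continuous.
Qed.

Lemma trace_bounded : exists M, forall x, closure Om x -> `|t x| <= M.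
Proof.
have [ct _] := ht.
have /ex_strict_bound_gt0[M M0 hM] :=
  compact_bounded (continuous_compact ct (compact_closure bO)).
by exists M => x Ox; apply/ltW/(hM (t x)); exists x.
Qed.

Lemma trace_integrable : mu.-integrable Om (EFin \o t).
Proof.
apply: integrable_bounded => //; first exact: trace_measurable.
by have [M hM] := trace_bounded; exists M => x Ox; apply: hM; exact: subset_closure.
Qed.

Let Rintegral_trace h : measurable_fun setT h ->
  \int[mu]_(x in Om) (phi x * h x) = \int[mu]_(x in Om) (t x * h x).
Proof.
move=> mh; rewrite /Rintegral; congr fine; apply: ae_eq_integral => //.
- apply/measurable_EFinP; apply: measurable_funM; last exact: measurable_funTS.
  by apply: Linfty_measurable => //; have [] := W.
- apply/measurable_EFinP; apply: measurable_funM; last exact: measurable_funTS.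
  exact: trace_measurable.
- have [_] := ht; apply: filterS => x h1 Ox; by rewrite h1.
Qed.

Local Notation zero := (fun=> 0%N : nat).
Let Z e := \int[mu]_x mol e (0 : 'rV[R]_n) zero x.
Let cube (c : 'rV[R]_n) e := [set x : 'rV[R]_n | forall i, `|x ord0 i - c ord0 i| <= e].

Let bsupp_mol e (c : 'rV[R]_n) : 0 < e -> bsupp (mol e c zero).
Proof.
move=> e0; apply: (bsupp_test (Om := setT)).
exact: test_function_mol.
Qed.

Let Rintegral_mol e c : 0 < e -> \int[mu]_x mol e c zero x = Z e.
Proof.
move=> e0; rewrite -(Rintegral_shift c (bsupp_mol c e0)).
by apply: eq_Rintegral => x _; rewrite mol_shift addrK.
Qed.

Let Z_gt0 e : 0 < e -> 0 < Z e.
Proof.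
move=> e0; rewrite lt_def; apply/andP; split; last first.
  by apply: Rintegral_ge0 => x _; exact: mol_ge0.
apply/negP => /eqP Z0.
have h := Rintegral_ge0_eq0 measurableT (bsupp_integrable (bsupp_mol 0 e0))
  (aeW _ (fun x _ => mol_ge0 e 0 x)) Z0.
have o0 : [set y : 'rV[R]_n | enorm (y - 0) < e] 0 by rewrite /= subrr enorm0.
have [x /= xe] := ae_open_point (@open_enorm_ball R n 0 e) o0 h.
move=> /(_ I)/eqP; rewrite gt_eqF// mol_gt0// => i.
by rewrite mxE subr0; apply: le_lt_trans (coord_le_enorm _ _) _; rewrite -[x]subr0.
Qed.

(** The weak gradient identities are summed against v before any estimate, so that v.G appears and
    Cauchy-Schwarz gives the sharp Euclidean constant. *)
Let test_partial_sum e c (v : 'rV[R]_n) : 0 < e -> cube c e `<=` Om ->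
  \int[mu]_(x in Om) (t x * - \sum_(i < n) v ord0 i * mol e c (fun j => (i == j)%N : nat) x)
    <= enorm v * Z e.
Proof.
move=> e0 cO; have tp : test_function Om (mol e c zero) by exact: test_function_mol.
have [_ LG wG] := W.
have part i : partial i (mol e c zero) = mol e c (fun j => (i == j)%N : nat).
  by rewrite partial_mol; congr (mol _ _ _); apply/funext => j; rewrite addn0.
have mm k : measurable_fun setT (mol e c k).
  by apply: measurable_continuous; exact: continuous_mol.
have mb k : exists M, forall x, `|mol e c k x| <= M.
  by have [M _ hM] := mol_bounded (n := n) e k; exists M.
have iG i : mu.-integrable Om (EFin \o (fun x => G x ord0 i * mol e c zero x)).
  by apply: integrableM_bounded => //; exact: Linfty_integrable.
have itm i : mu.-integrable Om (EFin \o (fun x => t x * mol e c (fun j => (i == j)%N : nat) x)).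
  by apply: integrableM_bounded => //; exact: trace_integrable.
have sumE (s : seq 'I_n) (F : 'I_n -> 'rV[R]_n -> R) :
    (forall i, mu.-integrable Om (EFin \o F i)) ->
    mu.-integrable Om (EFin \o (fun x => \sum_(i <- s) F i x)) /\
    \int[mu]_(x in Om) (\sum_(i <- s) F i x) = \sum_(i <- s) \int[mu]_(x in Om) F i x.
  move=> iF; elim: s => [|i s [IH1 IH2]].
    under eq_fun do rewrite big_nil; rewrite big_nil; split.
      by apply: integrable_bounded => //; exists 0 => x _; rewrite normr0.
    by rewrite Rintegral_cst// mul0r.
  under eq_fun do rewrite big_cons; rewrite big_cons -IH2; split.
    have := integrableD mO (iF i) IH1.
    by apply: eq_integrable.
  by rewrite RintegralD.
have Zl (a : R) F : mu.-integrable Om (EFin \o F) ->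
    mu.-integrable Om (EFin \o (fun x => a * F x)).
  by move=> iF; have := integrableZl mO a iF; apply: eq_integrable.
have iv i : mu.-integrable Om (EFin \o (fun x => v ord0 i * (G x ord0 i * mol e c zero x))).
  exact: Zl.
have iw i : mu.-integrable Om (EFin \o
    (fun x => - v ord0 i * (t x * mol e c (fun j => (i == j)%N : nat) x))).
  exact: Zl.
have -> : \int[mu]_(x in Om) (t x * - \sum_(i < n) v ord0 i * mol e c (fun j => (i == j)%N : nat) x) =
    \int[mu]_(x in Om) (\sum_(i < n) (v ord0 i * (G x ord0 i * mol e c zero x))).
  have [_ ->] := sumE (index_enum 'I_n) _ iv.
  transitivity (\int[mu]_(x in Om) (\sum_(i < n) (- v ord0 i * (t x * mol e c (fun j => (i == j)%N : nat) x)))).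
    apply: eq_Rintegral => x _; rewrite mulrN mulr_sumr -sumrN.
    by apply: eq_bigr => i _; rewrite mulNr mulrCA.
  have [_ ->] := sumE (index_enum 'I_n) _ iw.
  apply: eq_bigr => i _; rewrite !RintegralZl//.
  have := wG i _ tp; rewrite part Rintegral_trace// => ->.
  by rewrite mulNr mulrN opprK.
have -> : enorm v * Z e = \int[mu]_(x in Om) (enorm v * mol e c zero x).
  rewrite RintegralZl//; last first.
    apply: (@integrableS _ _ _ _ setT) => //; exact: bsupp_integrable (bsupp_mol c e0).
  rewrite Rintegral_supp ?Rintegral_mol// => x Ox; exact: (test_eq0 tp).
have ae1 := ae_le_Lnormy G1.
apply: ae_le_Rintegral => //.
- by have [] := sumE (index_enum 'I_n) _ iv.
- apply: (Zl (enorm v)).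
  by apply: (@integrableS _ _ _ _ setT) => //; exact: bsupp_integrable (bsupp_mol c e0).
- apply: filterS ae1 => x; rewrite /= lee_fin patchE => + Ox.
  rewrite mem_set// ger0_norm ?enorm_ge0//= => Gx1.
  have -> : \sum_(i < n) v ord0 i * (G x ord0 i * mol e c zero x) = dot v (G x) * mol e c zero x.
    by rewrite mulr_suml; apply: eq_bigr => i _; rewrite mulrA.
  rewrite ler_wpM2r ?mol_ge0//; apply: le_trans (cauchy_schwarz _ _) _.
  by rewrite ler_piMr// enorm_ge0.
Qed.

Let mollified e (a v : 'rV[R]_n) (s : R) := \int[mu]_(x in Om) (t x * mol e (a + s *: v) zero x).

(** Mean value theorem on the segment from a to a + v: differentiating under the integral moves the
    mollifier, and [test_partial_sum] bounds that derivative. *)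
Let mollified_le e a v : 0 < e ->
  (forall s, 0 <= s <= 1 -> cube (a + s *: v) e `<=` Om) ->
  mollified e a v 1 - mollified e a v 0 <= enorm v * Z e.
Proof.
move=> e0 cO.
have [M hM] := trace_bounded.
have {}hM x : Om x -> `|t x| <= M by move=> Ox; apply: hM; exact: subset_closure.
pose f (s : R) x := t x * mol e (a + s *: v) zero x.
pose df (s : R) x := t x * - \sum_(i < n) v ord0 i * mol e (a + s *: v) (fun j => (i == j)%N : nat) x.
have dfE (s : R) (x : 'rV[R]_n) : is_derive s 1 (f ^~ x) (df s x).
  have := is_deriveZ (t x) (is_derive_mol_center e a v x s).
  by [].
have [B [B0 hB]] : exists B, 0 <= B /\ forall s x, Om x -> `|df s x| <= B.
  have /choice[C hC] : forall i : 'I_n, exists C, 0 <= C /\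
      forall c x, `|mol e c (fun j => (i == j)%N : nat) x| <= C.
    by move=> i; have [C C0 h] := mol_bounded (n := n) e (fun j => (i == j)%N : nat); exists C.
  exists (`|M| * \sum_(i < n) `|v ord0 i| * C i); split.
    by rewrite mulr_ge0// sumr_ge0// => i _; rewrite mulr_ge0//; have [] := hC i.
  move=> s x Ox; rewrite normrM; apply: ler_pM => //.
    by apply: le_trans (hM x Ox) (ler_norm _).
  rewrite normrN; apply: le_trans (ler_norm_sum _ _ _) _; apply: ler_sum => i _.
  by rewrite normrM ler_wpM2l//; have [_] := hC i.
have intf s : mu.-integrable Om (EFin \o f s).
  apply: integrableM_bounded => //; first exact: trace_integrable.
    by apply: measurable_continuous; exact: continuous_mol.
  by have [C _ hC] := mol_bounded (n := n) e zero; exists C.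
have intB : mu.-integrable Om (EFin \o (cst B : 'rV[R]_n -> R)).
  by apply: integrable_bounded => //; exists B => x _; rewrite ger0_norm.
have d1E s x : partial1of2 f s x = df s x.
  by rewrite partial1of2E; have [_] := dfE s x.
have hd (s : R) : is_derive s 1 (mollified e a v) (\int[mu]_(x in Om) df s x).
  have Is : `]s - 1, s + 1[%classic s by rewrite /= in_itv/= ltrDl gtrBl ltr01.
  have der : forall s' y, `]s - 1, s + 1[%classic s' -> Om y -> derivable (f ^~ y) s' 1.
    by move=> s' y _ _; have [] := dfE s' y.
  have ub : forall s' y, `]s - 1, s + 1[%classic s' -> Om y ->
      `|partial1of2 f s' y| <= cst B y.
    by move=> s' y _ Oy; rewrite d1E; exact: hB.
  apply: DeriveDef.
    exact: (@derivable_under_integral _ _ _ mu f Om mO s _ _ Is (fun s' _ => intf s') der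
      (cst B) (fun _ => B0) intB ub).
  rewrite -derive1E.
  rewrite (@differentiation_under_integral _ _ _ mu f Om mO s _ _ Is (fun s' _ => intf s') der
      (cst B) (fun _ => B0) intB ub).
  by apply: eq_Rintegral => x _; rewrite d1E.
have cm : {within `[0, 1], continuous (mollified e a v)}.
  by apply: derivable_within_continuous => s _; have [] := hd s.
have [s] := MVT ltr01 (fun s _ => hd s) cm.
rewrite in_itv/= => /andP[s0 s1] ->; rewrite subr0 mulr1.
by apply: test_partial_sum => //; apply: cO; rewrite !ltW.
Qed.

(* Moving the center of the mollifier amounts to testing the weak gradient
   against it, so the mollifications of [t] are 1-Lipschitz. *)
Lemma trace_lipschitz (z : 'rV[R]_n) r a b :
  (forall x, enorm (x - z) < r -> Om x) -> enorm (a - z) < r -> enorm (b - z) < r ->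
  t b - t a <= enorm (b - a).
Proof.
move=> zO ar br.
apply/ler_addgt0Pl => d d0.
pose d2 := d / 2; have d20 : 0 < d2 by rewrite divr_gt0.
have near_ c : Om c -> exists2 e, 0 < e & forall x, enorm (x - c) < e -> `|t x - t c| <= d2.
  move=> Oc.
  have /(@cvgrPdist_le _ _ _ _ (nbhs_filter c))/(_ _ d20) := trace_continuous Oc.
  move=> /nbhs_ballP[e e0 he]; exists e => // x xc.
  rewrite distrC; apply: he; rewrite -ball_normE/= distrC.
  exact: le_lt_trans (normr_le_enorm _) xc.
have [ea ea0 hea] := near_ a (zO _ ar); have [eb eb0 heb] := near_ b (zO _ br).
(* The norm is convex, so every point of the segment from a to b is at least this far inside the
   ball, and cubes centred on the segment fit too. *)
pose rho := r - Num.max (enorm (a - z)) (enorm (b - z)).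
have rho0 : 0 < rho by rewrite subr_gt0 gt_max ar br.
pose m := Num.min rho (Num.min ea eb).
have m0 : 0 < m by rewrite !lt_min rho0 ea0 eb0.
pose e := m / (2 * n.+1%:R).
have e0 : 0 < e by rewrite divr_gt0// mulr_gt0.
have cube_enorm c x : cube c e x -> enorm (x - c) < m.
  move=> cx; apply: le_lt_trans (enorm_le_normr _) _.
  apply: (@le_lt_trans _ _ (n.+1%:R * e)).
    apply: ler_pM => //; first by rewrite ler_nat.
    rewrite normr_rV_le ?(ltW e0)//; apply/forallP => i.
    by rewrite !mxE; exact: cx.
  have -> : n.+1%:R * e = m / 2 by rewrite /e; field; rewrite nat1r pnatr_eq0.
  by rewrite ltr_pdivrMr// ltr_pMr// ltr1n.
have cO s : 0 <= s <= 1 -> cube (a + s *: (b - a)) e `<=` Om.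
  move=> /andP[s0 s1] x /cube_enorm xm; apply: zO.
  apply: le_lt_trans (enorm_triangle (a + s *: (b - a)) _ _) _.
  have -> : a + s *: (b - a) - z = (1 - s) *: (a - z) + s *: (b - z).
    by apply/rowP => j; rewrite !mxE; ring.
  have cvx : enorm ((1 - s) *: (a - z) + s *: (b - z)) <= Num.max (enorm (a - z)) (enorm (b - z)).
    apply: le_trans (enormD _ _) _; rewrite !enormZ !ger0_norm ?subr_ge0//.
    have hA : enorm (a - z) <= Num.max (enorm (a - z)) (enorm (b - z)).
      by rewrite le_max lexx.
    have hB : enorm (b - z) <= Num.max (enorm (a - z)) (enorm (b - z)).
      by rewrite le_max lexx orbT.
    move: (Num.max _ _) hA hB => X hA hB.
    have : s * enorm (b - z) <= s * X by exact: ler_wpM2l.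
    have : (1 - s) * enorm (a - z) <= (1 - s) * X by rewrite ler_wpM2l// subr_ge0.
    lra.
  have mr : m <= r - Num.max (enorm (a - z)) (enorm (b - z)) by rewrite ge_min lexx.
  move: mr cvx xm; set X := Num.max _ _; lra.
have Zm c : cube c e `<=` Om -> \int[mu]_(x in Om) mol e c zero x = Z e.
  move=> cO'; rewrite Rintegral_supp ?Rintegral_mol// => x Ox.
  apply: (test_eq0 (Om := Om)) => //; exact: test_function_mol.
have itm c : mu.-integrable Om (EFin \o (fun x => t x * mol e c zero x)).
  apply: integrableM_bounded => //; first exact: trace_integrable.
    by apply: measurable_continuous; exact: continuous_mol.
  by have [C _ hC] := mol_bounded (n := n) e zero; exists C.
have imc c k : mu.-integrable Om (EFin \o (fun x => k * mol e c zero x)).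
  apply: integrable_bounded => //.
    apply: measurable_funTS; apply: measurable_continuous.
    by apply: continuous_mulr; [exact: cst_continuous|exact: continuous_mol].
  have [C _ hC] := mol_bounded (n := n) e zero; exists (`|k| * C) => x _.
  by rewrite normrM ler_wpM2l.
(* The mollifier is not normalised: up to the factor Z e, the mollified value at c is within d2 of t
   c. The two end points together cost d. *)
have est c : cube c e `<=` Om -> (forall x, enorm (x - c) < m -> `|t x - t c| <= d2) ->
    (t c - d2) * Z e <= \int[mu]_(x in Om) (t x * mol e c zero x) <= (t c + d2) * Z e.
  move=> cO' tc.
  have imc1 : mu.-integrable Om (EFin \o mol e c zero).
    by have := imc c 1; apply: eq_integrable => // x _; rewrite /= mul1r.
  rewrite -(Zm c cO') -!RintegralZl//; apply/andP; split; apply: le_Rintegral => // x Ox.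
    have [->|h] := eqVneq (mol e c zero x) 0; first by rewrite !mulr0.
    have := tc x (cube_enorm c x (mol_support e0 h)); rewrite ler_norml => /andP[h1 h2].
    by apply: ler_wpM2r; [exact: mol_ge0|lra].
  have [->|h] := eqVneq (mol e c zero x) 0; first by rewrite !mulr0.
  have := tc x (cube_enorm c x (mol_support e0 h)); rewrite ler_norml => /andP[h1 h2].
  by apply: ler_wpM2r; [exact: mol_ge0|lra].
have := mollified_le e0 cO; rewrite /mollified scale0r addr0.
have -> : a + 1 *: (b - a) = b by rewrite scale1r addrC subrK.
have le01 : (0 <= 0 :> R) && (0 <= 1 :> R) by rewrite lexx ler01.
have cOa : cube a e `<=` Om by have := cO 0; rewrite scale0r addr0 lexx ler01; apply.
have cOb : cube b e `<=` Om.
  by have := cO 1; rewrite scale1r addrC subrK lexx ler01; apply.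
have ma : m <= ea by rewrite !ge_min lexx !orbT.
have mb : m <= eb by rewrite !ge_min lexx !orbT.
have /andP[_] := est a cOa (fun x xm => hea x (lt_le_trans xm ma)).
have /andP[+ _] := est b cOb (fun x xm => heb x (lt_le_trans xm mb)).
move=> h1 h2 h3.
have : (t b - t a - d) * Z e <= enorm (b - a) * Z e.
  have -> : (t b - t a - d) * Z e = (t b - d2) * Z e - (t a + d2) * Z e.
    by rewrite /d2; field.
  by apply: le_trans h3; apply: lerB.
rewrite ler_pM2r ?Z_gt0//; lra.
Qed.

End fixed.
End trace_lipschitz.

(** * Hausdorff measure of the boundary *)

Section hausdorff_boundary.
Context {R : realType} {n : nat}.
Implicit Types (x y v p : 'rV[R]_n) (Om A : set 'rV[R]_n).

Lemma dot_mulmx m (x y : 'rV[R]_m) : dot x y = (x *m y^T) ord0 ord0.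
Proof. by rewrite mxE; apply: eq_bigr => i _; rewrite mxE. Qed.

Lemma enorm_mulmx (Q : 'M[R]_n) x : Q *m Q^T = 1%:M -> enorm (x *m Q) = enorm x.
Proof.
by move=> QQ; rewrite !enormE !dot_mulmx trmx_mul mulmxA -(mulmxA x) QQ mulmx1.
Qed.

Lemma ediam_ge0 A : (0 <= ediam A)%E.
Proof. by apply: ereal_sup_ubound; left. Qed.

Lemma enorm_le_ediam A x y : A x -> A y -> ((enorm (x - y))%:E <= ediam A)%E.
Proof. by move=> Ax Ay; apply: ereal_sup_ubound; right; exists (x, y). Qed.

(* Each covering set projects into a cube of radius its diameter; compare the
   Lebesgue measures. *)
Lemma hausdorff_gt0 s (pi : 'rV[R]_n -> 'rV[R]_s) A (c : 'rV[R]_s) (r : R) : 0 < r ->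
  (forall x y i, `|pi x ord0 i - pi y ord0 i| <= enorm (x - y)) ->
  (forall z : 'rV[R]_s, (forall i, `|z ord0 i - c ord0 i| <= r) ->
     exists2 x, A x & pi x = z) ->
  hausdorff s A <> 0%E.
Proof.
move=> r0 lpi piA H0.
have pre0 : (hausdorff_pre s 1 A <= 0)%E.
  by rewrite -H0; apply: ereal_sup_ubound; exists 1 => //=; exact: ltr01.
(* A cover whose sum of ediam^s is below r^s is contradictory: the cubes of radii [rho k] cover one
   of volume (2 r)^s, and 2^s cancels. *)
have rs0 : (0 < (r ^+ s)%:E)%E by rewrite lte_fin exprn_gt0.
have [_ [F [AF dF] <-] sumF] := ereal_inf_lt (le_lt_trans pre0 rs0).
have /choice[rho hrho] : forall k, exists rk : R, ediam (F k) = rk%:E.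
  move=> k; have := dF k; have := ediam_ge0 (F k).
  by case: (ediam (F k)) => // rk _ _; exists rk.
have rho0 k : 0 <= rho k by rewrite -lee_fin -hrho; exact: ediam_ge0.
pose cube (a : 'rV[R]_s) e := [set v : 'rV[R]_s | forall i, `|v ord0 i - a ord0 i| <= e].
have /choice[C hC] : forall k, exists a : 'rV[R]_s, pi @` (F k) `<=` cube a (rho k).
  move=> k; have [[a Fa]|nF] := pselect (exists a, F k a); last first.
    by exists 0 => u [y Fy]; case: nF; exists y.
  exists (pi a) => _ [y Fy <-] i /=; apply: le_trans (lpi _ _ _) _.
    by rewrite -lee_fin -hrho; exact: enorm_le_ediam.
have cover : cube c r `<=` \bigcup_k cube (C k) (rho k).
  move=> z /piA[x Ax <-]; have [k _ Fx] := AF x Ax.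
  by exists k => //; apply: hC; exists x.
have : (lebesgue_rV s (cube c r) <= \sum_(0 <= k <oo) lebesgue_rV s (cube (C k) (rho k)))%E.
  exact: (measure_sigma_subadditive (lebesgue_rV s) (fun k => measurable_cube (C k) (rho k))
    (measurable_cube c r) cover).
rewrite lebesgue_rV_cube ?(ltW r0)//.
have -> : (\sum_(0 <= k <oo) lebesgue_rV s (cube (C k) (rho k)) =
  (2 ^+ s)%:E * \sum_(0 <= k <oo) ediam (F k) ^+ s)%E.
  rewrite -nneseriesZl; last by move=> k _; rewrite hrho -EFin_expe lee_fin exprn_ge0.
  apply: eq_eseriesr => k _; rewrite lebesgue_rV_cube// hrho -EFin_expe -EFinM.
  by rewrite exprMn.
rewrite exprMn EFinM lee_pmul2l ?lte_fin ?exprn_gt0//.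
by rewrite leNgt sumF.
Qed.

Lemma hausdorff_le s A B : A `<=` B -> (hausdorff s A <= hausdorff s B)%E.
Proof.
move=> AB; apply: ge_ereal_sup => _ [d /= d0 <-].
apply: (@le_trans _ _ (hausdorff_pre s d B)); last first.
  by apply: ereal_sup_ubound; exists d.
apply: ereal_inf_le_tmp => _ [F [BF dF] <-]; exists F => //; split => //.
exact: subset_trans AB BF.
Qed.

Lemma hausdorff_ge0 s A : (0 <= hausdorff s A)%E.
Proof.
apply: (@le_trans _ _ (hausdorff_pre s 1 A)); last first.
  by apply: ereal_sup_ubound; exists 1 => //=; exact: ltr01.
apply: le_ereal_inf_tmp => _ [F _ <-]; apply: nneseries_ge0 => k _ _.
exact: expe_ge0 (ediam_ge0 _).
Qed.

(** For s = 0 each empty covering set would count 0^0 = 1. Here s = n - 1, which is where n >= 2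
    enters. *)
Lemma hausdorff_set0 s : (0 < s)%N -> hausdorff s (set0 : set 'rV[R]_n) = 0%E.
Proof.
move=> s0; apply/eqP; rewrite eq_le hausdorff_ge0 andbT.
apply: ge_ereal_sup => _ [d /= d0 <-].
apply: ereal_inf_lbound; exists (fun=> set0).
  split=> // k; apply: ge_ereal_sup => _ /= [->|[[x y] [[]]]]; rewrite lee_fin ltW//.
apply: eseries0 => k _ _.
have -> : ediam (set0 : set 'rV[R]_n) = 0%E.
  apply/eqP; rewrite eq_le ediam_ge0 andbT.
  by apply: ge_ereal_sup => _ /= [->//|[[x y] [[]]]].
by rewrite -EFin_expe expr0n gtn_eqF.
Qed.

(** In rotated coordinates the boundary near y0 is the graph of g. Dropping the vertical coordinate
    does not increase distances and maps this piece onto a set containing a cube of dimension n -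
    1. *)
Lemma hausdorff_boundary_neq0 Om y0 (rho : R) : open Om -> lipschitz_boundary Om ->
  boundary Om y0 -> 0 < rho ->
  hausdorff n.-1 [set y | boundary Om y /\ enorm (y - y0) < rho] <> 0%E.
Proof.
move=> oO lO by0 rho0.
have [r [Q [i [g [L [r0 QQ Lg OmE]]]]]] := lO y0 by0.
have g_lip z z' : `|g z - g z'| <= `|L| * `|z - z'|.
  by apply: le_trans (Lg (z, z') (conj I I)) _; rewrite /= ler_wpM2r// ler_norm.
pose pi (x : 'rV[R]_n) : 'rV[R]_n.-1 := col' i (x *m Q).
have lpi x y j : `|pi x ord0 j - pi y ord0 j| <= enorm (x - y).
  rewrite -(enorm_mulmx (x - y) QQ) !mxE.
  apply: le_trans (coord_le_enorm _ (lift i j)).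
  by rewrite mulmxBl !mxE.
have lpi' x y : `|pi x - pi y| <= enorm (x - y).
  rewrite normr_rV_le ?enorm_ge0//; apply/forallP => j.
  by have := lpi x y j; rewrite !mxE.
pose p0 := y0 *m Q.
have [cl0 nO0] : closure Om y0 /\ ~ Om y0.
  by move: by0; rewrite boundary_openE// => -[].
(* A point strictly above the graph would be in Om. Strictly below it, points of Om close to y0
   would be too, as the height varies by at most |x - y0| and g by at most |L| |x - y0|. *)
have p0E : p0 ord0 i = g (pi y0).
  apply/eqP; rewrite eq_le; apply/andP; split.
    rewrite leNgt; apply/negP => h; apply: nO0; apply/OmE => //.
    by rewrite subrr enorm0.
  rewrite leNgt; apply/negP => h.
  pose e := (g (pi y0) - p0 ord0 i) / (2 + `|L|).
  have L2 : 0 < 2 + `|L| by rewrite ltr_wpDr.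
  have e0 : 0 < e by rewrite divr_gt0// subr_gt0.
  pose m := Num.min e r; have m0 : 0 < m by rewrite lt_min e0 r0.
  have o0 : [set y | enorm (y - y0) < m] y0 by rewrite /= subrr enorm0.
  have [x [Ox xm]] := cl0 _ (open_nbhs_nbhs (conj (@open_enorm_ball R n y0 m) o0)).
  have xe : enorm (x - y0) < e by apply: lt_le_trans xm _; rewrite ge_min lexx.
  have xr : enorm (x - y0) < r by apply: lt_le_trans xm _; rewrite ge_min lexx orbT.
  move/(OmE x xr): Ox => gx.
  have h1 : `|g (pi x) - g (pi y0)| <= `|L| * enorm (x - y0).
    by apply: le_trans (g_lip _ _) _; rewrite ler_wpM2l.
  have h2 : `|(x *m Q) ord0 i - p0 ord0 i| <= enorm (x - y0).
    rewrite -(enorm_mulmx (x - y0) QQ) mulmxBl.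
    by apply: le_trans (coord_le_enorm _ i); rewrite !mxE.
  have h3 : (1 + `|L|) * enorm (x - y0) < g (pi y0) - p0 ord0 i.
    have -> : g (pi y0) - p0 ord0 i = (2 + `|L|) * e by rewrite mulrC divfK// gt_eqF.
    apply: (@le_lt_trans _ _ ((2 + `|L|) * enorm (x - y0))).
      by rewrite ler_wpM2r ?enorm_ge0// lerD2r ler1n.
    by rewrite ltr_pM2l.
  move: h1 h2; rewrite !ler_norml => /andP[h11 h12] /andP[h21 h22].
  have : g (pi x) < (x *m Q) ord0 i by exact: gx.
  lra.
(* The point above z at height s over the graph; X is the same point in the original coordinates. *)
pose P (z : 'rV[R]_n.-1) (s : R) : 'rV[R]_n :=
  \row_j (if unlift i j is Some k then z ord0 k else g z + s).
have P_i z s : P z s ord0 i = g z + s by rewrite mxE unlift_none.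
have P_col z s : col' i (P z s) = z by apply/rowP => j; rewrite !mxE liftK.
pose X z s := P z s *m Q^T.
have XQ z s : X z s *m Q = P z s by rewrite -mulmxA (mulmx1C QQ) mulmx1.
have piX z s : pi (X z s) = z by rewrite /pi XQ P_col.
pose mm := Num.min r rho; have mm0 : 0 < mm by rewrite lt_min r0 rho0.
(* A horizontal move by eta and a lift by s <= eta change each coordinate by at most (1 + |L| + 1)
   eta; n + 1 converts the sup norm into the Euclidean one. *)
pose K := n.+1%:R * (1 + `|L| + 1).
have K0 : 0 < K by rewrite mulr_gt0// ltr_wpDl// addr_ge0.
pose eta := mm / (2 * K); have eta0 : 0 < eta by rewrite divr_gt0// mulr_gt0.
have Xy0 (z : 'rV[R]_n.-1) (s : R) : (forall j, `|z ord0 j - pi y0 ord0 j| <= eta) -> 0 <= s <= eta ->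
    enorm (X z s - y0) < mm.
  move=> hz /andP[s0 s1].
  have hz' : `|z - pi y0| <= eta.
    rewrite normr_rV_le ?(ltW eta0)//; apply/forallP => j; rewrite !mxE.
    by have := hz j; rewrite !mxE.
  rewrite -(enorm_mulmx (X z s - y0) QQ) mulmxBl XQ -/p0.
  apply: le_lt_trans (enorm_le_normr _) _.
  apply: (@le_lt_trans _ _ (n.+1%:R * ((1 + `|L| + 1) * eta))).
    apply: ler_pM => //; first by rewrite ler_nat.
    rewrite normr_rV_le; last by rewrite mulr_ge0 ?(ltW eta0)// !addr_ge0.
    apply/forallP => j; rewrite mxE [(- p0) _ _]mxE; have [k ->|->] := unliftP i j.
      rewrite mxE liftK.
      have := hz k; rewrite /pi mxE -/p0 => h; apply: le_trans h _.
      by rewrite ler_peMl ?(ltW eta0)// -addrA lerDl addr_ge0.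
    rewrite P_i p0E addrAC; apply: le_trans (ler_normD _ _) _.
    have h1 := le_trans (g_lip z (pi y0)) (ler_wpM2l (normr_ge0 L) hz').
    rewrite (ger0_norm s0); lra.
  rewrite mulrA -/K /eta; have -> : K * (mm / (2 * K)) = mm / 2.
    by field; rewrite gt_eqF.
  by rewrite ltr_pdivrMr// ltr_pMr// ltr1n.
have OX (z : 'rV[R]_n.-1) (s : R) : (forall j, `|z ord0 j - pi y0 ord0 j| <= eta) -> 0 <= s <= eta ->
    Om (X z s) <-> 0 < s.
  move=> hz hs; have h := Xy0 z s hz hs.
  have hr : enorm (X z s - y0) < r by apply: lt_le_trans h _; rewrite ge_min lexx.
  rewrite (OmE _ hr) XQ P_col P_i ltrDl//.
apply: (hausdorff_gt0 (pi := pi) (c := pi y0) eta0) => // z hz.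
have eta00 : 0 <= (0 : R) <= eta by rewrite lexx ltW.
exists (X z 0) => //; split; last first.
  by apply: lt_le_trans (Xy0 z 0 hz eta00) _; rewrite ge_min lexx orbT.
rewrite boundary_openE//; split; last by move/(OX z 0 hz eta00); rewrite ltxx.
move=> B /nbhs_ballP[e e0 eB].
(* Points slightly above the graph lie in Om, so the graph point is in the closure. *)
pose s := Num.min eta (e / 2).
have s0 : 0 < s by rewrite lt_min eta0 divr_gt0.
have hs : 0 <= s <= eta by rewrite (ltW s0)/= ge_min lexx.
exists (X z s); split; first by apply/(OX z s hz hs).
apply: eB; rewrite -ball_normE/=.
apply: le_lt_trans (normr_le_enorm _) _.
rewrite -(enorm_mulmx _ QQ) mulmxBl !XQ.
have -> : P z 0 - P z s = - s *: delta_mx ord0 i.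
  apply/rowP => j; rewrite !mxE eqxx/=; have [k ->|->] := unliftP i j.
    by rewrite subrr eq_sym (negbTE (neq_lift _ _)) mulr0.
  by rewrite eqxx mulr1; ring.
rewrite enormZ enorm_delta mulr1 normrN gtr0_norm//.
by apply: (@le_lt_trans _ _ (e / 2)); [rewrite ge_min lexx orbT|rewrite ltr_pdivrMr// ltr_pMr// ltr1n].
Qed.

(** If |t y0| > 1/beta, continuity keeps |t| above some admissible essential bound M on a boundary
    piece around y0, which is not negligible. *)
Lemma trace_boundary_le Om (t : 'rV[R]_n -> R) (beta : R) : open Om ->
  lipschitz_boundary Om -> 0 < beta -> {within closure Om, continuous t} ->
  (beta%:E * Linfty_norm_boundary Om t <= 1)%E ->
  forall y, boundary Om y -> `|t y| <= beta^-1.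
Proof.
move=> oO lO b0 ct hb y0 by0; rewrite leNgt; apply/negP => ty0.
have : (Linfty_norm_boundary Om t < `|t y0|%:E)%E.
  apply: le_lt_trans (_ : _ <= (beta^-1)%:E)%E _; last by rewrite lte_fin.
  by rewrite -[leRHS]mule1 lee_pdivlMl.
move=> /ereal_inf_lt[M [M0 HM] Mt].
have /(_ y0) h := (subspace_continuousP _ _).1 ct.
have cl0 : closure Om y0 by move: by0; rewrite boundary_openE// => -[].
have {}h := cvg_norm (FF := within_filter _ (nbhs_filter y0)) (h cl0).
case: M M0 HM Mt => [M| |]// M0 HM; rewrite lte_fin => Mt.
have := cvgr_gt (FF := within_filter _ (nbhs_filter y0)) _ h _ Mt.
rewrite /within/= => /nbhs_ballP[e e0 he].
apply: (hausdorff_boundary_neq0 oO lO by0 e0).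
apply/eqP; rewrite eq_le hausdorff_ge0 andbT -HM; apply: hausdorff_le.
move=> y [by_ ye]; split=> //; rewrite lte_fin; apply: he.
  rewrite -ball_normE/= distrC; exact: le_lt_trans (normr_le_enorm _) ye.
by move: by_; rewrite boundary_openE// => -[].
Qed.

End hausdorff_boundary.

(** * Minimizers *)

Section minimizers.
Context {R : realType} {n : nat}.
Local Notation mu := (@lebesgue_rV R n).
Implicit Types (u t phi f : 'rV[R]_n -> R) (x : 'rV[R]_n).
Variables (Om : set 'rV[R]_n) (beta : R).
Hypotheses (n2 : (2 <= n)%N) (oO : open Om) (bO : bounded_set Om)
  (lO : lipschitz_boundary Om) (beta0 : 0 < beta).
Local Notation d := (dist_boundary Om).
Local Notation v := (v_infty Om beta).

Let mO : measurable Om := measurable_open_rV oO.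

Let n1 : (0 < n.-1)%N. Proof. by rewrite -ltnS prednK// ltnW. Qed.

Lemma Linfty_norm_boundary_le t : (forall y, boundary Om y -> `|t y| <= beta^-1) ->
  (beta%:E * Linfty_norm_boundary Om t <= 1)%E.
Proof.
move=> tb.
apply: (@le_trans _ _ (beta%:E * (beta^-1)%:E)%E); last first.
  by rewrite -EFinM mulfV// gt_eqF.
apply: lee_wpmul2l; first by rewrite lee_fin ltW.
apply: ereal_inf_lbound; split; first by rewrite lee_fin invr_ge0 ltW.
rewrite (_ : [set y | _] = set0) ?hausdorff_set0//.
apply/seteqP; split=> // y [by_]; rewrite lte_fin => h.
by have := tb y by_; rewrite leNgt h.
Qed.

Lemma admissible_set0 phi : Om = set0 -> admissible Om beta phi.
Proof.
move=> O0; exists (fun=> 0), phi; split.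
- split.
  + by apply: Linfty_bounded => //; [rewrite O0; exact: measurable_fun_set0|exists 0; rewrite O0].
  + by move=> i; apply: Linfty_bounded => //; exists 0; rewrite O0.
  + by move=> i psi _; rewrite O0 !Rintegral_set0 oppr0.
- apply: Lnormy_le => //; apply: aeW => x /=; rewrite O0 patchE memNset//.
  by rewrite normr0.
- split; last by apply: aeW => x; rewrite O0.
  rewrite O0 closure0; apply/subspace_continuousP => x [].
- apply: Linfty_norm_boundary_le => y; rewrite O0 /boundary closure0.
  by case.
Qed.

Section nonempty.
Hypothesis bne : boundary Om !=set0.

Lemma tame_admissible u : lip1 u -> (forall x, Om x -> tame u x) ->
  (forall y, boundary Om y -> `|u y| <= beta^-1) -> admissible Om beta u.
Proof.
move=> lu tu ub; have [G W G1] := tame_W1infty oO bO bne lu tu.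
exists G, u; split=> //; last exact: Linfty_norm_boundary_le.
split; last exact: aeW.
apply: continuous_subspaceT; exact: lip1_continuous.
Qed.

Lemma admissible_v : admissible Om beta v.
Proof.
apply: tame_admissible.
- exact: lip1B (lip1_dist bne).
- by move=> x Ox; apply: tameD; exact: tame_dist.
- by move=> y by_; rewrite /v_infty dist_boundary0// addr0 ger0_norm// invr_ge0 ltW.
Qed.

Lemma trace_le_v phi G t : W1infty Om phi G -> (Linfty_norm Om (enorm \o G) <= 1)%E ->
  has_trace Om phi t -> (beta%:E * Linfty_norm_boundary Om t <= 1)%E ->
  forall x, Om x -> t x <= v x.
Proof.
move=> W G1 ht tb x Ox; rewrite leNgt; apply/negP => vt.
have [y by_ xy] := dist_attained bne bO x.
have ty : t y <= beta^-1.
  apply: le_trans (ler_norm _) _.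
  by apply: (trace_boundary_le oO lO beta0 ht.1 tb).
have dx0 := dist_gt0 bne oO bO Ox.
pose gap := t x - d x - t y.
have gap0 : 0 < gap by move: vt; rewrite /v_infty /gap; lra.
have cly : closure Om y by move: by_; rewrite boundary_openE// => -[].
have h := (subspace_continuousP _ _).1 ht.1 y cly.
have := (@cvgrPdist_lt _ _ _ _ (within_filter _ (nbhs_filter y)) _ _).1 h gap gap0.
move=> /nbhs_ballP[e e0 he].
(* Since s < 1, p stays in the open ball B(x, d x) where the trace is 1-Lipschitz; since (1 - s) d x
   <= e / 2, p is close enough to y for continuity. *)
pose s := Num.max (1 / 2) (1 - e / (2 * d x)).
have e2d : 0 < e / (2 * d x) by rewrite divr_gt0// mulr_gt0.
have s0 : 0 < s by rewrite lt_max divr_gt0.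
have s1 : s < 1 by rewrite gt_max; apply/andP; split; lra.
pose p := x + s *: (y - x).
have px : enorm (p - x) = s * d x.
  by rewrite /p addrC addKr enormZ gtr0_norm// enorm_distC xy.
have pd : enorm (p - x) < d x by rewrite px gtr_pMl.
have Op : Om p := dist_ball bne oO Ox pd.
have py : enorm (p - y) < e.
  have -> : p - y = (1 - s) *: (x - y).
    by apply/rowP => j; rewrite !mxE; ring.
  rewrite enormZ xy ger0_norm ?subr_ge0 ?(ltW s1)//.
  have : 1 - e / (2 * d x) <= s by rewrite le_max lexx orbT.
  rewrite -ltr_pdivlMr// => hs.
  apply: (@le_lt_trans _ _ (e / (2 * d x))); first by lra.
  by rewrite ltr_pM2l// ltf_pV2 ?posrE ?mulr_gt0// ltr_pMl// ltr1n.
have tp : `|t y - t p| < gap.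
  apply: he; last exact: subset_closure.
  rewrite -ball_normE/=; apply: le_lt_trans (normr_le_enorm _) _.
  by rewrite enorm_distC.
have xx : enorm (x - x) < d x by rewrite subrr enorm0.
have := trace_lipschitz oO bO W G1 ht (fun z hz => dist_ball bne oO Ox hz) pd xx.
rewrite enorm_distC => /le_lt_trans/(_ pd) h1.
move: tp; rewrite ltr_norml /gap => /andP[h2 _].
suff : t p < t p by rewrite ltxx.
lra.
Qed.

Section data.
Variable f : 'rV[R]_n -> R.
Hypotheses (Lf : Linfty Om f) (f0 : {ae mu, forall x, Om x -> 0 <= f x}).

Let Lv : Linfty Om v.
Proof. by have [G [t [[]]]] := admissible_v. Qed.

Lemma v_minimal phi : admissible Om beta phi -> J_infty Om f v <= J_infty Om f phi.
Proof.
move=> [G [t [W G1 ht tb]]]; have [Lphi _ _] := W.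
rewrite /J_infty lerN2; apply: ae_le_Rintegral => //; [exact: Linfty_integrableM..|].
have [_ htr] := ht; apply: filterS2 htr f0 => x e fx Ox.
by rewrite ler_wpM2l ?fx// -e//; exact: (trace_le_v W G1 ht tb).
Qed.

(** Equal values of J make f (v - t), which is nonnegative, vanish almost everywhere. So f = 0 on
    the open set where t < v, and this set misses the essential support. *)
Lemma minimizer_eq_on_singular phi G t : W1infty Om phi G ->
  (Linfty_norm Om (enorm \o G) <= 1)%E -> has_trace Om phi t ->
  (beta%:E * Linfty_norm_boundary Om t <= 1)%E ->
  J_infty Om f phi <= J_infty Om f v ->
  forall x, Om x -> ess_support Om f x -> t x = v x.
Proof.
move=> W G1 ht tb Jle x Ox sx; have [Lphi _ _] := W; have [_ htr] := ht.
have tv := trace_le_v W G1 ht tb.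
apply/eqP; rewrite eq_le tv//= leNgt; apply/negP => txv; apply: sx.
have ifv : mu.-integrable Om (EFin \o (fun x => f x * v x)) by exact: Linfty_integrableM.
have ifp : mu.-integrable Om (EFin \o (fun x => f x * phi x)) by exact: Linfty_integrableM.
have J0 : \int[mu]_(x in Om) (f x * v x - f x * phi x) = 0.
  rewrite RintegralB//; apply/eqP; rewrite subr_eq0 eq_le.
  apply/andP; split; first by move: Jle; rewrite /J_infty lerN2.
  by rewrite -lerN2; apply: v_minimal; exists G, t.
have idiff : mu.-integrable Om (EFin \o (fun x => f x * v x - f x * phi x)).
  by have := integrableB mO ifv ifp; apply: eq_integrable.
have ge0 : {ae mu, forall x, Om x -> 0 <= f x * v x - f x * phi x}.
  apply: filterS2 htr f0 => y e fy Oy.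
  by rewrite -mulrBr mulr_ge0 ?fy// subr_ge0 -e//; exact: tv.
have ae0 := Rintegral_ge0_eq0 mO idiff ge0 J0.
exists [set y | Om y /\ t y < v y] => //; split.
  rewrite openE => y [Oy tvy]; apply: filterI; first exact: open_nbhs_nbhs.
  have cv : {for y, continuous v}.
    exact: (lip1_continuous (lip1B (beta^-1) (lip1_dist bne))).
  have ct : {for y, continuous t} := trace_continuous oO ht Oy.
  have := continuousB cv ct; rewrite /continuous_at => hc.
  have pos : 0 < (v - t) y by rewrite /= subr_gt0.
  have := cvgr_gt (FF := nbhs_filter y) _ hc _ pos.
  by apply: filterS => z /=; rewrite subr_gt0.
apply: filterS2 htr ae0 => y e fy Oy [_ tvy].
have := fy Oy; rewrite -mulrBr -e// => /eqP.
by rewrite mulf_eq0 subr_eq0 (gt_eqF tvy) orbF => /eqP.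
Qed.

Lemma minimizer_unique phi : singular_set Om `<=` ess_support Om f ->
  admissible Om beta phi -> J_infty Om f phi <= J_infty Om f v ->
  {ae mu, forall x, Om x -> phi x = v x}.
Proof.
move=> sf [G [t [W G1 ht tb]]] Jle.
have tv := trace_le_v W G1 ht tb.
have teq := minimizer_eq_on_singular W G1 ht tb Jle.
suff tvE x : Om x -> t x = v x.
  by have [_] := ht; apply: filterS => x e Ox; rewrite -e// tvE.
move=> Ox; apply/eqP; rewrite eq_le tv//= leNgt; apply/negP => txv.
have dx0 := dist_gt0 bne oO bO Ox.
have [M M0 hM] : exists2 M, 0 < M & forall w, Om w -> d w <= M.
  have [N N0 hN] := bounded_enorm bO; have [y by_] := bne.
  exists (N + enorm y); first by rewrite ltr_wpDr// enorm_ge0.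
  move=> w Ow; apply: le_trans (dist_le bne w by_) _.
  by apply: le_trans (enormD _ _) _; rewrite enormN lerD2r hN.
(* With e = |w - x| below, c is chosen so that c e < gap. The part gap <= d x puts x in B(w, d w);
   the part gap <= v x - t x contradicts the Lipschitz bound from w. *)
pose gap := Num.min (v x - t x) (d x).
have gap0 : 0 < gap by rewrite lt_min subr_gt0 txv dx0.
pose c := Num.min (1 / 2) (gap / (4 * M)).
have c0 : 0 < c by rewrite lt_min !divr_gt0// mulr_gt0.
have c2 : c <= 1 / 2 by rewrite ge_min lexx.
have cM : 4 * M * c <= gap.
  have : c <= gap / (4 * M) by rewrite ge_min lexx orbT.
  by rewrite ler_pdivlMr ?mulr_gt0// mulrC.
have lam01 : 0 <= 1 - c < 1 by apply/andP; split; lra.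
have [w sw dw] := singular_climb bne oO bO Ox lam01.
have Ow := sw.1.
set e := enorm (w - x) in dw.
have e0 : 0 <= e := enorm_ge0 _.
have dwM := hM w Ow.
(* As c <= 1/2, the climb from x to w gives e / 2 <= d w <= M, a bound independent of c. *)
have eM : e <= 2 * M.
  have : 1 / 2 * e <= (1 - c) * e by apply: ler_wpM2r => //; lra.
  have := dist_ge0 bne x; lra.
have ce : c * e < gap.
  apply: (@le_lt_trans _ _ (c * (2 * M))); first by apply: ler_wpM2l => //; exact: ltW.
  have : 0 < M * c by rewrite mulr_gt0.
  lra.
have gd : gap <= d x by rewrite ge_min lexx orbT.
have gv : gap <= v x - t x by rewrite ge_min lexx.
have xw : enorm (x - w) < d w by rewrite enorm_distC -/e; lra.
have ww : enorm (w - w) < d w by rewrite subrr enorm0; apply: dist_gt0.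
have := trace_lipschitz oO bO W G1 ht (fun z hz => dist_ball bne oO Ow hz) xw ww.
rewrite -/e (teq w Ow (sf _ sw)) => h.
move: gv h; rewrite /v_infty; lra.
Qed.

(* Rounding the cone [d x0 - e + |. - x0|] at its vertex and truncating [d] by it
   lowers [v] near [x0] and changes it only where [f] vanishes. *)
Lemma singular_sub_ess_support :
  (forall phi, admissible Om beta phi -> J_infty Om f phi = J_infty Om f v ->
    {ae mu, forall x, Om x -> phi x = v x}) ->
  singular_set Om `<=` ess_support Om f.
Proof.
move=> uniq x0 sx0 [U [oU fU] Ux0].
have Ox0 := sx0.1.
have [r1 r10 r1U] := open_enormP oU Ux0.
have [e /andP[e0 ed] he] := singular_gap bne oO bO sx0 r10.
(* The rounded cone has height d x0 - e / 2 at its vertex, strictly below d x0, and elsewhere stays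
   above the cone of [singular_gap], hence above d outside U. *)
pose c := (e / 2) ^+ 2.
have c0 : 0 < c by rewrite exprn_gt0// divr_gt0.
pose w x := d x0 - e + hyperb c x0 x.
pose u x := beta^-1 + Num.min (d x) (w x).
have lw : lip1 w by apply: lip1B; exact/lip1_hyperb/ltW.
have lu : lip1 u by apply: lip1B; apply: lip1_min => //; exact: lip1_dist.
have hpos x : 0 < hyperb c x0 x by rewrite sqrtr_gt0 ltr_wpDr// dot_ge0.
have tu x : Om x -> tame u x.
  move=> Ox; apply: tameD; apply: tame_min => //; first exact: lip1_dist.
    exact: tame_dist.
  by apply: tameD; apply: tame_hyperb => //; exact: ltW.
have w0 x : 0 <= w x by rewrite addr_ge0 ?subr_ge0// hyperb_ge0.
have ub y : boundary Om y -> `|u y| <= beta^-1.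
  move=> by_; rewrite /u dist_boundary0// min_l ?w0// addr0 ger0_norm//.
  by rewrite invr_ge0 ltW.
have au : admissible Om beta u by exact: tame_admissible.
have uv x : Om x -> ~ U x -> u x = v x.
  move=> Ox Ux; rewrite /u min_l// /w.
  apply: (@le_trans _ _ (d x0 - e + enorm (x - x0))).
    apply: he; first exact: subset_closure.
    by rewrite leNgt; apply/negP => /r1U.
  by rewrite lerD2l enorm_le_hyperb// ltW.
have Lu : Linfty Om u by have [G [t [[]]]] := au.
have Juv : J_infty Om f u = J_infty Om f v.
  rewrite /J_infty; congr (- _); rewrite /Rintegral; congr fine.
  apply: ae_eq_integral => //.
  - by apply/measurable_EFinP; apply: measurable_funM; exact: Linfty_measurable.
  - by apply/measurable_EFinP; apply: measurable_funM; exact: Linfty_measurable.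
  apply: filterS fU => x fx Ox; have [Ux|Ux] := pselect (U x).
    by rewrite fx// !mul0r.
  by rewrite uv.
have h := uniq u au Juv.
have ux0 : u x0 < v x0.
  rewrite /u /v_infty ltrD2l gt_min; apply/orP; right.
  rewrite /w /hyperb subrr -(scale0r 0) dotZl mul0r addr0 /c sqrtr_sqr.
  rewrite ger0_norm; last by rewrite divr_ge0// ltW.
  lra.
have cuv : continuous (fun x => v x - u x).
  apply: continuous_subr; apply: lip1_continuous => //.
  exact: lip1B (lip1_dist bne).
have oV : open (Om `&` [set x | 0 < v x - u x]).
  apply: openI => //.
  by have /continuousP/(_ [set s | 0 < s]) := cuv; apply; exact: open_gt.
have pos : 0 < v x0 - u x0 by rewrite subr_gt0.
have [y [Oy vy] E] := ae_open_point oV (conj Ox0 pos) h.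
by move: vy; rewrite /= (E Oy) subrr ltxx.
Qed.

End data.
End nonempty.
End minimizers.

Theorem theorem4p5 (R : realType) (n : nat) (Om : set 'rV[R]_n) (beta : R)
    (f : 'rV[R]_n -> R) :
  (2 <= n)%N ->
  open Om -> bounded_set Om -> lipschitz_boundary Om ->
  0 < beta ->
  Linfty Om f -> {ae @lebesgue_rV R n, forall x, Om x -> 0 <= f x} ->
  unique_minimizer Om (admissible Om beta) (J_infty Om f) (v_infty Om beta) <->
  singular_set Om `<=` ess_support Om f.
Proof.
move=> n2 oO bO lO beta0 Lf f0.
(* An empty Om has no boundary point to project on; every clause is then vacuous or an integral over
   the empty set. *)
have [[x0 Ox0]|nO] := pselect (exists x, Om x); last first.
  have O0 : Om = set0.
    by apply/seteqP; split=> // x Ox; apply: nO; exists x.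
  split=> [_ x [Ox]|_]; first by rewrite O0 in Ox.
  split; first exact: admissible_set0.
  - by move=> phi _; rewrite /J_infty O0 !Rintegral_set0.
  - by move=> phi _ _; apply: aeW => x; rewrite O0.
have bne : boundary Om !=set0 by apply: boundary_nonempty Ox0 => //; exact: ltnW.
have vmin := v_minimal n2 oO bO lO beta0 bne Lf f0.
split=> [[av _ uniq]|sf].
  apply: (singular_sub_ess_support n2 oO bO beta0 bne Lf) => phi aphi Jphi.
  by apply: uniq => // psi /vmin; rewrite Jphi.
split=> //; first exact: admissible_v.
move=> phi aphi hphi; apply: (minimizer_unique n2 oO bO lO beta0 bne Lf f0 sf aphi).
by apply: hphi; exact: admissible_v.
Qed.
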